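(* Let $A\in\mathbb{R}^{n\times n}$ and $b\in\mathbb{R}^n$ be such that $(A,b)$ satisfies the Kalman rank condition. Then, as $T\to0^+$, the worst-case minimum control energy satisfies $$\sup_{\|y\|=1}\ \inf_{\substack{u\in L^2(0,T)\\ x(0)=0,\ x(T)=y}}\int_0^T|u(t)|^2\,dt=\frac{T^{-(2n-1)}}{\kappa_nd_n(A,b)^2}\,(1-a_nT+\mathrm{O}(T^2)),$$ where $x$ denotes the solution of $\dot x(t)=Ax(t)+bu(t)$. Moreover, $$\det G_T(A,b)=(\det K_b)^2\,\det\mathfrak{H}_n\,T^{n^2}\,(1+\operatorname{tr}(A)T+\mathrm{O}(T^2)),$$ where $K_b=(b,Ab,\ldots,A^{n-1}b)$ and $\mathfrak{H}_n=\big(\tfrac{1}{(i-1)!(j-1)!(i+j-1)}\big)_{1\le i,j\le n}$. Finally, $$\frac{\lambda_1(T)}{\lambda_n(T)}=\frac{d_1(A,b)^2}{\kappa_nd_n(A,b)^2}\,T^{-2(n-1)}\,(1+(a_1-a_n)T+\mathrm{O}(T^2)).$$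
   Context: $\langle\cdot,\cdot\rangle$ is the Euclidean scalar product on $\mathbb{R}^n$ and $\|\cdot\|$ its norm. The Kalman rank condition is $\operatorname{rank}(b,Ab,\ldots,A^{n-1}b)=n$. For $T>0$, the controllability Gramian is $G_T(A,b)=\int_0^Te^{tA}bb^\top e^{tA^\top}\,dt$, with eigenvalues ordered decreasingly $\lambda_1(T)\ge\cdots\ge\lambda_n(T)>0$. Krylov data: $\mathcal{K}_k(A,b)=\operatorname{span}(b,Ab,\ldots,A^{k-1}b)$, $\mathcal{K}_0(A,b)=\{0\}$. The orthonormal basis $(q_1,\ldots,q_n)$ is obtained by Gram–Schmidt from $b,Ab,\ldots,A^{n-1}b$, characterized by $q_k\in\mathcal{K}_k(A,b)$, $q_k\perp\mathcal{K}_{k-1}(A,b)$, $d_k(A,b):=\langle q_k,A^{k-1}b\rangle>0$. Set $a_k=\langle q_k,Aq_k\rangle$ for $k\in\{1,\ldots,n\}$, and $\kappa_k=\frac{((k-1)!)^2}{(2k-1)!\,(2k-2)!}$. *)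

(* Defs.v *)
From HB Require Import structures.
From mathcomp Require Import all_boot all_order all_algebra.
From mathcomp Require Import all_classical all_reals all_analysis.

Set Implicit Arguments.
Unset Strict Implicit.
Unset Printing Implicit Defensive.
Import Order.TTheory GRing.Theory Num.Theory.
Import numFieldNormedType.Exports.

Local Open Scope classical_set_scope.
Local Open Scope ring_scope.

(* The norm of the library on matrices is the sup norm, hence the
   explicit Euclidean structure. *)
Definition dotp (R : realType) (n : nat) (u v : 'cV[R]_n) : R :=
  \sum_(i < n) u i 0 * v i 0.

Definition enorm (R : realType) (n : nat) (u : 'cV[R]_n) : R :=
  Num.sqrt (dotp u u).

Definition expmx (R : realType) (n : nat) (M : 'M[R]_n) : 'M[R]_n :=
  limn (series (fun k : nat => (k`!%:R)^-1 *: M ^+ k)).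

Definition krylov_mx (R : realType) (n : nat) (A : 'M[R]_n) (b : 'cV[R]_n) :
    'M[R]_n :=
  \matrix_(i < n, j < n) (A ^+ j *m b) i 0.

Definition kalman (R : realType) (n : nat) (A : 'M[R]_n) (b : 'cV[R]_n) :
    Prop :=
  \rank (krylov_mx A b) = n.

Definition gramian (R : realType) (n : nat) (A : 'M[R]_n) (b : 'cV[R]_n)
    (T : R) : 'M[R]_n :=
  \matrix_(i < n, j < n)
    \int[lebesgue_measure]_(t in `[0, T])
      (expmx (t *: A) *m b *m b^T *m expmx (t *: A^T)) i j.

(* The eigenvalues, repeated according to their algebraic multiplicity and in
   nonincreasing order.  The list is unique, and it exists when [M] is
   symmetric; [[::]] is a junk value for the matrices whose characteristic
   polynomial does not split over [R]. *)
Definition eigenvalues (R : realType) (n : nat) (M : 'M[R]_n) : seq R :=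
  xget [::] [set s : seq R | sorted >=%R s /\
                             char_poly M = \prod_(x <- s) ('X - x%:P)].

(* [lambda A b T k] is the [k]-th largest eigenvalue, counted from 1. *)
Definition lambda (R : realType) (n : nat) (A : 'M[R]_n) (b : 'cV[R]_n)
    (T : R) (k : nat) : R :=
  nth 0 (eigenvalues (gramian A b T)) k.-1.

(* The first [k] vectors produced by the Gram-Schmidt process applied to
   [b, A b, A^2 b, ...]. *)
Fixpoint gram_schmidt (R : realType) (n : nat) (A : 'M[R]_n) (b : 'cV[R]_n)
    (k : nat) : seq 'cV[R]_n :=
  if k is j.+1 then
    let s := gram_schmidt A b j in
    let w := A ^+ j *m b in
    let v := w - \sum_(q <- s) dotp q w *: q in
    rcons s ((enorm v)^-1 *: v)
  else [::].

(* In the next four definitions [k] is counted from 1. *)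
Definition krylov_q (R : realType) (n : nat) (A : 'M[R]_n) (b : 'cV[R]_n)
    (k : nat) : 'cV[R]_n :=
  nth 0 (gram_schmidt A b k) k.-1.

Definition krylov_d (R : realType) (n : nat) (A : 'M[R]_n) (b : 'cV[R]_n)
    (k : nat) : R :=
  dotp (krylov_q A b k) (A ^+ k.-1 *m b).

Definition krylov_a (R : realType) (n : nat) (A : 'M[R]_n) (b : 'cV[R]_n)
    (k : nat) : R :=
  dotp (krylov_q A b k) (A *m krylov_q A b k).

Definition kappa (R : realType) (k : nat) : R :=
  ((k - 1)`!%:R) ^+ 2 / ((2 * k - 1)`!%:R * (2 * k - 2)`!%:R).

(* Rows and columns are counted from 0 here, which shifts the usual entries
   [1 / ((i-1)! (j-1)! (i+j-1))]. *)
Definition hilbert_fact_mx (R : realType) (n : nat) : 'M[R]_n :=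
  \matrix_(i < n, j < n) ((i`! * j`! * (i + j + 1))%:R)^-1.

Definition L2_control (R : realType) (T : R) (u : R -> R) : Prop :=
  measurable_fun `]0, T[ u /\
  lebesgue_measure.-integrable `]0, T[ (fun t => (`|u t| ^+ 2)%:E).

(* Solution on [0, T] of [x' = A x + b u] in the sense of Caratheodory, for a
   control [u] that is merely integrable: [x] is continuous and satisfies the
   integrated equation (equivalently, [x] is absolutely continuous and the
   differential equation holds almost everywhere). *)
Definition is_solution (R : realType) (n : nat) (A : 'M[R]_n) (b : 'cV[R]_n)
    (T : R) (u : R -> R) (x : R -> 'cV[R]_n) : Prop :=
  {within `[0, T], continuous x} /\
  forall t : R, 0 <= t <= T -> forall i : 'I_n,
    x t i 0 = x 0 i 0 +
      \int[lebesgue_measure]_(s in `[0, t]) (A *m x s + u s *: b) i 0.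

Definition admissible (R : realType) (n : nat) (A : 'M[R]_n) (b : 'cV[R]_n)
    (T : R) (y : 'cV[R]_n) : set (R -> R) :=
  [set u | L2_control T u /\
           exists x : R -> 'cV[R]_n,
             [/\ is_solution A b T u x, x 0 = 0 & x T = y]].

Definition energy (R : realType) (T : R) (u : R -> R) : \bar R :=
  (\int[lebesgue_measure]_(t in `]0%R, T[) (`|u t| ^+ 2)%:E)%E.

Definition worst_energy (R : realType) (n : nat) (A : 'M[R]_n) (b : 'cV[R]_n)
    (T : R) : \bar R :=
  ereal_sup [set ereal_inf (energy T @` admissible A b T y)
            | y in [set y : 'cV[R]_n | enorm y = 1]].

(* Main.v *)
Require Import Defs.
From HB Require Import structures.
From mathcomp Require Import all_boot all_order all_algebra.
From mathcomp Require Import all_classical all_reals all_analysis.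
From mathcomp Require Import measurable_realfun fingroup perm complex ring lra zify.

(** Every unit vector [y] is reached with minimal energy [<y, G^-1 y>], where [G]
    is the Gramian: a trajectory from 0 satisfies
    [\int_0^T (z e^{(T-t)A} b) u(t) dt = z x(T)] for every row [z], so with
    [w(t) = z e^{(T-t)A} b] and [G z^T = y] the energies of [u] and [w] satisfy
    [|u|^2 >= 2 <u, w> - |w|^2 = z y], with equality for [u = w]
    ([control_duality], [optimal_state_solution], [min_energy]). The worst energy
    over unit vectors is therefore the inverse of the least eigenvalue of [G]
    ([worst_energyE]), and all three expansions are statements about [G].

    In the basis [b, A b, ..., A^m b], with [m = n - 1], the [i]-th coordinate of
    [e^{tA} b] is [t^i / i!] up to [O(t^{i+2})], except for the last one, which has
    the further term [tr(A) t^n / n!], because [A] is a companion matrix in this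
    basis. Hence the Gramian in this basis has the entries [T^{i+j+1} h_ij(T)],
    where [h(T) = H + T E + O(T^2)] with [H] the factorial Hilbert matrix and [E]
    an explicit matrix proportional to [tr A] ([scaled_gramian_expansion]).

    The matrix [H] is the Gram matrix of the monomials [s^i / i!] in L2(0, 1), so
    Legendre polynomials give the entries of its inverse that are needed:
    [(H^-1)_{mm} = 1 / kappa_n] and [(H^-1)_{m,m-1} = - 1 / (2 kappa_n)], as well
    as the number [1/2] that makes [tr (H^-1 E) = tr A] and
    [(H^-1 E H^-1)_{mm} = tr A / kappa_n]. The determinant follows at once.

    For the extreme eigenvalues, a positive form [P] and a unit vector [q] satisfy
    [<q, P q> <= largest eigenvalue of P <= tr P]. For [P = G] and [q = q_1] both
    ends equal [d_1^2 T (1 + a_1 T + O(T^2))]. For [P = G^-1] and [q = q_n] both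
    ends equal [T^{-(2n-1)} (1 - a_n T + O(T^2)) / (kappa_n d_n^2)]: at these two
    orders only the last row and the last column of the form in the basis
    [b, A b, ...] count, and there the identity and the projection on [q_n] agree,
    because [q_n] is orthogonal to [b, A b, ..., A^{m-1} b]. The coefficient [a_n]
    arises as [tr A + d_n xi_{m-1}], with [xi] the coordinates of [q_n]
    ([krylov_aE], [expansion1_invmx_gramian]). *)

Set Implicit Arguments.
Unset Strict Implicit.
Unset Printing Implicit Defensive.
Import Order.TTheory GRing.Theory Num.Theory.
Import numFieldNormedType.Exports.

Local Open Scope classical_set_scope.
Local Open Scope ring_scope.

(** * Quadratic forms and eigenvalues of symmetric matrices *)

Lemma dotpE (R : realType) n (u v : 'cV[R]_n) : dotp u v = (u^T *m v) 0 0.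
Proof. by rewrite mxE; apply: eq_bigr => i _; rewrite mxE. Qed.

(** [P] is unitarily diagonalizable over the complex numbers, with real
    eigenvalues; [w i] is the squared modulus of the [i]-th coordinate of [z]
    in the eigenbasis. Only the real data [d] and [w] are kept. *)
Lemma symmetric_spectral (R : realType) n (P : 'M[R]_n) : P^T = P ->
  exists2 d : 'I_n -> R, char_poly P = \prod_i ('X - (d i)%:P) &
  forall z : 'cV[R]_n, exists2 w : 'I_n -> R, (forall i, 0 <= w i) &
    dotp z z = \sum_i w i /\ dotp z (P *m z) = \sum_i d i * w i.
Proof.
move=> symP.
pose toC := real_complex R : {rmorphism R -> R[i]}.
pose A := map_mx toC P.
have realA : A \is a realmx.
  by apply/mxOverP => i j; rewrite mxE; apply/complex_realP; exists (P i j).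
have symA : A \is symmetricmx.
  apply/is_hermitianmxP; rewrite expr0 scale1r map_mx_id //.
  by rewrite /A map_trmx symP.
have hermA := realsym_hermsym symA realA.
have /orthomx_spectralP := hermitian_normalmx hermA.
set U := spectralmx A; set D := spectral_diag A => AE.
have Uunit : U \in unitmx by exact: spectral_unit.
have realD i : (complex.Re (D 0 i))%:C%C = D 0 i.
  by apply: RRe_real; move/mxOverP: (hermitian_spectral_diag_real hermA); exact.
have UV : invmx U = (map_mx Num.conj U)^T.
  by rewrite map_trmx; apply: invmx_unitary; exact: spectral_unitarymx.
exists (fun i => complex.Re (D 0 i)).
  apply: (@map_inj_poly _ _ toC); [exact: complexI | exact: rmorph0 |].
  rewrite -[LHS]/(map_poly toC _) map_char_poly -/A rmorph_prod /= AE.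
  transitivity (char_poly (diag_mx D)).
    have polyUVU : map_mx polyC (invmx U) *m map_mx polyC U = 1%:M.
      by rewrite -map_mxM mulVmx // map_mx1.
    rewrite /char_poly /char_poly_mx.
    have -> : 'X%:M - map_mx polyC (invmx U *m diag_mx D *m U) =
      map_mx polyC (invmx U) *m ('X%:M - map_mx polyC (diag_mx D)) *m map_mx polyC U.
      rewrite mulmxBr mulmxBl !map_mxM /= mul_mx_scalar -scalemxAl.
      by rewrite polyUVU scalemx1.
    by rewrite !det_mulmx mulrAC -det_mulmx polyUVU det1 mul1r.
  rewrite char_poly_trig; last first.
    by apply/is_trig_mxP => i j ij; rewrite mxE -val_eqE /= ltn_eqF.
  apply: eq_bigr => i _.
  by rewrite mxE eqxx rmorphB /= map_polyX map_polyC /= realD.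
move=> z; pose y := U *m map_mx toC z.
have yT : (map_mx toC z)^T *m invmx U = (map_mx Num.conj y)^T.
  rewrite UV map_mxM trmx_mul; congr (_ *m _).
  congr (_^T); apply/matrixP => i j; rewrite !mxE; apply/eqP.
  by rewrite eq_complex /= oppr0 !eqxx.
exists (fun i => complex.Re (y i 0) ^+ 2 + complex.Im (y i 0) ^+ 2).
  by move=> i; rewrite addr_ge0 // sqr_ge0.
have wE i : toC (complex.Re (y i 0) ^+ 2 + complex.Im (y i 0) ^+ 2) =
    Num.conj (y i 0) * y i 0.
  by rewrite mulrC /= /toC /= add_Re2_Im2 normCK.
have toCE (M : 'M[R]_1) : toC (M 0 0) = map_mx toC M 0 0 by rewrite mxE.
split; apply: complexI; rewrite -[LHS]/(toC _) -[RHS]/(toC _) dotpE toCE.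
  have -> : map_mx toC (z^T *m z) = (map_mx Num.conj y)^T *m y.
    by rewrite -yT /y !mulmxA mulmxKV // map_mxM map_trmx.
  by rewrite mxE rmorph_sum; apply: eq_bigr => i _; rewrite wE !mxE.
have -> : map_mx toC (z^T *m (P *m z)) = (map_mx Num.conj y)^T *m diag_mx D *m y.
  by rewrite -yT /y !map_mxM -map_trmx -/A [in LHS]AE -!mulmxA.
rewrite mul_mx_diag mxE rmorph_sum; apply: eq_bigr => i _.
rewrite [toC _]rmorphM wE -[toC (complex.Re _)]/((complex.Re (D 0 i))%:C%C) realD !mxE.
by rewrite mulrCA mulrA.
Qed.

Lemma dotp_ge0 (R : realType) n (u : 'cV[R]_n) : 0 <= dotp u u.
Proof. by apply: sumr_ge0 => i _; rewrite -expr2 sqr_ge0. Qed.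

Lemma dotp_eq0 (R : realType) n (u : 'cV[R]_n) : (dotp u u == 0) = (u == 0).
Proof.
apply/eqP/eqP => [|->]; last by rewrite /dotp big1 // => i _; rewrite mxE mul0r.
move/psumr_eq0P => u0; apply/matrixP => i j; rewrite ord1 mxE.
by apply/eqP; rewrite -sqrf_eq0 expr2 u0 // => k _; rewrite -expr2 sqr_ge0.
Qed.

Lemma dotpC (R : realType) n (u v : 'cV[R]_n) : dotp u v = dotp v u.
Proof. by apply: eq_bigr => i _; rewrite mulrC. Qed.

Lemma dotpDr (R : realType) n (u v w : 'cV[R]_n) :
  dotp u (v + w) = dotp u v + dotp u w.
Proof. by rewrite !dotpE mulmxDr mxE. Qed.

Lemma dotpZr (R : realType) n a (u v : 'cV[R]_n) :
  dotp u (a *: v) = a * dotp u v.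
Proof. by rewrite !dotpE -scalemxAr mxE. Qed.

Lemma dotpZl (R : realType) n a (u v : 'cV[R]_n) :
  dotp (a *: u) v = a * dotp u v.
Proof. by rewrite dotpC dotpZr dotpC. Qed.

Lemma dotpBr (R : realType) n (u v w : 'cV[R]_n) :
  dotp u (v - w) = dotp u v - dotp u w.
Proof. by rewrite -scaleN1r dotpDr dotpZr mulN1r. Qed.

Lemma enorm_normalize (R : realType) n (v : 'cV[R]_n) : v != 0 ->
  dotp ((enorm v)^-1 *: v) ((enorm v)^-1 *: v) = 1.
Proof.
move=> v0; have vv : 0 < dotp v v by rewrite lt_def dotp_ge0 dotp_eq0 v0.
rewrite dotpZr dotpZl mulrA -expr2 exprVn sqr_sqrtr ?dotp_ge0 //.
by rewrite mulVf // gt_eqF.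
Qed.

Lemma eigenvaluesP (R : realType) n (P : 'M[R]_n) : P^T = P ->
  sorted >=%R (eigenvalues P) /\
  char_poly P = \prod_(x <- eigenvalues P) ('X - x%:P).
Proof.
move=> symP; have [d dP _] := symmetric_spectral symP.
apply: (@xgetI _ [::] [set s : seq R | sorted >=%R s /\
  char_poly P = \prod_(x <- s) ('X - x%:P)] (sort >=%R (codom d))); split.
  by apply: sort_sorted => x y; exact: le_total.
rewrite (perm_big (codom d)) /=; last by rewrite perm_sort.
by rewrite codomE big_map big_enum.
Qed.

Lemma size_eigenvalues (R : realType) n (P : 'M[R]_n) : P^T = P ->
  size (eigenvalues P) = n.
Proof.
move=> symP; have [_ /(congr1 (fun p : {poly R} => size p))] := eigenvaluesP symP.
by rewrite size_char_poly size_prod_XsubC => -[].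
Qed.

Lemma eigenvalues_vector (R : realType) n (P : 'M[R]_n) k : P^T = P ->
  (k < n)%N -> exists2 v : 'cV[R]_n, dotp v v = 1 &
    P *m v = nth 0 (eigenvalues P) k *: v.
Proof.
move=> symP kn; have [_ cP] := eigenvaluesP symP.
have : eigenvalue P (nth 0 (eigenvalues P) k).
  rewrite eigenvalue_root_char cP root_prod_XsubC mem_nth //.
  by rewrite size_eigenvalues.
case/eigenvalueP => u uP u0.
exists ((enorm u^T)^-1 *: u^T); first by rewrite enorm_normalize // trmx_eq0.
by rewrite -scalemxAr -[in LHS]symP -trmx_mul uP linearZ /= scalerA mulrC -scalerA.
Qed.

Lemma eigenvalues_rayleigh (R : realType) n (P : 'M[R]_n) z : P^T = P ->
  nth 0 (eigenvalues P) n.-1 * dotp z z <= dotp z (P *m z) /\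
  dotp z (P *m z) <= nth 0 (eigenvalues P) 0 * dotp z z.
Proof.
move=> symP; have [sP cP] := eigenvaluesP symP.
have [d dP dz] := symmetric_spectral symP.
have [w w0 [-> ->]] := dz z.
have d_in i : d i \in eigenvalues P.
  rewrite -root_prod_XsubC -cP dP rootE horner_prod (bigD1 i) //=.
  by rewrite !hornerE subrr mul0r.
have dle i : nth 0 (eigenvalues P) n.-1 <= d i <= nth 0 (eigenvalues P) 0.
  have ltn := ltn_ord i.
  have trans_ge : transitive (>=%R : rel R) by move=> ? ? ? /[swap]; exact: le_trans.
  have refl_ge : reflexive (>=%R : rel R) by move=> ?; exact: lexx.
  have := d_in i => /(nthP 0) [k]; rewrite size_eigenvalues // => kn <-.
  by apply/andP; split; apply: (sorted_leq_nth trans_ge refl_ge 0 sP) => //;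
    rewrite ?inE ?size_eigenvalues //; lia.
by split; rewrite mulr_sumr; apply: ler_sum => i _; apply: ler_wpM2r => //;
  have /andP[] := dle i.
Qed.

(** Nonnegativity at [z j *: e_i - z i *: e_j] bounds each cross term of the
    quadratic form by diagonal entries. *)
Lemma psd_le_mxtrace (R : realType) n (P : 'M[R]_n) z : P^T = P ->
  (forall u, 0 <= dotp u (P *m u)) -> dotp z (P *m z) <= \tr P * dotp z z.
Proof.
move=> symP psdP.
have cross i j :
    2 * (z i 0 * P i j * z j 0) <= P i i * z j 0 ^+ 2 + P j j * z i 0 ^+ 2.
  have := psdP (z j 0 *: delta_mx i 0 - z i 0 *: delta_mx j 0).
  have Pd k l : dotp (delta_mx k 0 : 'cV[R]_n) (P *m delta_mx l 0) = P k l.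
    by rewrite dotpE trmx_delta mulmxA -rowE -colE !mxE.
  rewrite mulmxBr -!scalemxAr dotpBr !(dotpC (_ - _)) !dotpBr !dotpZr.
  rewrite !(dotpC (_ *: _)) !dotpZr !Pd.
  have -> : P j i = P i j by rewrite -[in LHS]symP mxE.
  by lra.
have -> : dotp z (P *m z) = \sum_i \sum_j z i 0 * P i j * z j 0.
  apply: eq_bigr => i _; rewrite mxE mulr_sumr.
  by apply: eq_bigr => j _; rewrite mulrA.
rewrite -(@ler_pM2l _ 2) // mulr_sumr.
under eq_bigr do rewrite mulr_sumr.
apply: (@le_trans _ _ (\sum_i \sum_j (P i i * z j 0 ^+ 2 + P j j * z i 0 ^+ 2))).
  by apply: ler_sum => i _; apply: ler_sum => j _; exact: cross.
under eq_bigr do rewrite big_split /=.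
rewrite big_split /= [X in _ + X]exchange_big /= mulr2n mulrDl mul1r.
suff -> : \sum_i \sum_j P i i * z j 0 ^+ 2 = \tr P * dotp z z by [].
rewrite /mxtrace mulr_suml; apply: eq_bigr => i _.
by rewrite mulr_sumr; apply: eq_bigr => j _; rewrite expr2.
Qed.

(** Expand [|P z| ^ 2 - l <z, P z> = |P z - l z| ^ 2 + l <z, P z - l z>]. *)
Lemma rayleigh_sqr (R : realType) n (P : 'M[R]_n) l (z : 'cV[R]_n) : 0 <= l ->
  l * dotp z z <= dotp z (P *m z) ->
  l * dotp z (P *m z) <= dotp (P *m z) (P *m z).
Proof.
move=> l0 lz; have := dotp_ge0 (P *m z - l *: z).
rewrite dotpBr !(dotpC (_ - _)) !dotpBr !(dotpZr, dotpZl) (dotpC (P *m z) z).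
by have := ler_wpM2l l0 lz; lra.
Qed.

Section PositiveForm.
Variables (R : realType) (n : nat) (P : 'M[R]_n).
Hypotheses (n_gt0 : (0 < n)%N) (symP : P^T = P).
Hypotheses (psdP : forall u, 0 <= dotp u (P *m u)) (uP : P \in unitmx).
Let l := nth 0 (eigenvalues P) n.-1.

Lemma last_eigenvalue_gt0 : 0 < l.
Proof.
have [|v v1 Pv] := @eigenvalues_vector _ _ P n.-1 symP; first by rewrite prednK.
rewrite lt_def; apply/andP; split; last first.
  by rewrite -[l]mulr1 -v1 -dotpZr -Pv.
apply/eqP => l0; have v0 : v = 0.
  by rewrite -(mulKmx uP v) Pv -/l l0 scale0r mulmx0.
by have /eqP := v1; rewrite v0 dotpE mulmx0 mxE eq_sym oner_eq0.
Qed.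

Lemma invmx_form_le y : dotp y (invmx P *m y) <= l^-1 * dotp y y.
Proof.
have l0 := last_eigenvalue_gt0.
have := rayleigh_sqr (ltW l0) (eigenvalues_rayleigh (invmx P *m y) symP).1.
by rewrite mulKVmx // [dotp (_ *m _) y]dotpC ler_pdivlMl.
Qed.

Lemma invmx_form_eq : exists2 v, dotp v v = 1 & dotp v (invmx P *m v) = l^-1.
Proof.
have l0 := last_eigenvalue_gt0.
have [|v v1 Pv] := @eigenvalues_vector _ _ P n.-1 symP; first by rewrite prednK.
exists v => //; rewrite -[X in invmx _ *m X](scale1r v) -(mulVf (lt0r_neq0 l0)).
by rewrite -scalerA -Pv -scalemxAr mulKmx // dotpZr v1 mulr1.
Qed.

(** The largest eigenvalue of a positive form lies between its value at a unit
    vector and its trace. When one eigenvalue dominates, a well-chosen [q]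
    makes both ends agree beyond the leading order, so no perturbation theory
    of eigenvalues is needed. Here this is applied to the inverse form. *)
Lemma last_eigenvalue_inv_bounds q : dotp q q = 1 ->
  dotp q (invmx P *m q) <= l^-1 <= \tr (invmx P).
Proof.
move=> q1; apply/andP; split; first by rewrite -[l^-1]mulr1 -q1; exact: invmx_form_le.
have [v v1 <-] := invmx_form_eq; rewrite -[\tr _]mulr1 -v1.
apply: psd_le_mxtrace => [|u]; first by rewrite trmx_inv symP.
by rewrite -[X in dotp X _](mulKVmx uP u) dotpC.
Qed.

Lemma first_eigenvalue_bounds q : dotp q q = 1 ->
  dotp q (P *m q) <= nth 0 (eigenvalues P) 0 <= \tr P.
Proof.
move=> q1; apply/andP; split.
  by rewrite -[leRHS]mulr1 -q1; exact: (eigenvalues_rayleigh q symP).2.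
have [v v1 Pv] := eigenvalues_vector symP n_gt0.
rewrite -[leLHS]mulr1 -v1 -dotpZr -Pv -[\tr P]mulr1 -v1.
exact: psd_le_mxtrace.
Qed.

End PositiveForm.

(** * Legendre polynomials and the factorial Hilbert matrix *)

Section UnitIntegral.
Variable R : realType.
Implicit Types p q : {poly R}.

(** The integral over [0, 1]. *)
Definition intp p : R := \sum_(i < size p) p`_i / i.+1%:R.

Lemma intpE N p : (size p <= N)%N -> intp p = \sum_(i < N) p`_i / i.+1%:R.
Proof.
move=> pN; rewrite /intp (big_ord_widen N (fun i => p`_i / i.+1%:R) pN).
rewrite [RHS](bigID (fun i : 'I_N => (i < size p)%N)) /=.
rewrite [X in _ = _ + X]big1 ?addr0 // => i.
by rewrite -leqNgt => ?; rewrite nth_default // mul0r.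
Qed.

Lemma intpD p q : intp (p + q) = intp p + intp q.
Proof.
pose N := maxn (size p) (size q).
rewrite (@intpE N (p + q)) ?size_polyD // (@intpE N p) ?leq_maxl //.
rewrite (@intpE N q) ?leq_maxr // -big_split /=.
by apply: eq_bigr => i _; rewrite coefD mulrDl.
Qed.

Lemma intpZ a p : intp (a *: p) = a * intp p.
Proof.
rewrite (intpE (size_scale_leq a p)) /intp mulr_sumr.
by apply: eq_bigr => i _; rewrite coefZ mulrA.
Qed.

Lemma intpMn p k : intp (p *+ k) = k%:R * intp p.
Proof. by rewrite -scaler_nat intpZ. Qed.

Lemma intpXn k : intp 'X^k = k.+1%:R^-1.
Proof.
rewrite /intp size_polyXn big_ord_recr /= coefXn eqxx mul1r big1 ?add0r // => i _.
by rewrite coefXn ltn_eqF // mul0r.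
Qed.

Lemma intp_deriv p : intp p^`() = p.[1] - p.[0].
Proof.
rewrite (@intpE (size p).-1); last first.
  have [->|/lt_size_deriv] := eqVneq p 0; first by rewrite linear0 size_poly0.
  by case: (size p).
rewrite horner_coef horner_coef0.
have [->|] := eqVneq p 0; first by rewrite size_poly0 !big_ord0 coef0 subr0.
rewrite -size_poly_gt0; case: (size p) => // k _ /=.
rewrite big_ord_recl expr1n mulr1 addrC addKr; apply: eq_bigr => i _.
by rewrite coef_deriv expr1n mulr1 -[X in X / _]mulr_natr mulfK // pnatr_eq0.
Qed.

Lemma intp_parts p q : (p * q).[0] = 0 -> (p * q).[1] = 0 ->
  intp (p * q^`()) = - intp (p^`() * q).
Proof.
move=> pq0 pq1; apply/eqP; rewrite -addr_eq0 addrC -intpD -derivM intp_deriv.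
by rewrite pq0 pq1 subrr.
Qed.

Lemma derivn_root a m j q : (j < m)%N -> (('X - a%:P) ^+ m * q)^`(j).[a] = 0.
Proof.
move=> jm; suff [s ->] : exists s,
    (('X - a%:P) ^+ m * q)^`(j) = ('X - a%:P) ^+ (m - j) * s.
  by rewrite hornerM horner_exp hornerXsubC subrr expr0n subn_eq0 leqNgt jm mul0r.
elim: j jm => [|j IH] jm; first by exists q; rewrite subn0.
have [s sE] := IH (ltnW jm); rewrite derivnS sE.
exists (s *+ (m - j) + ('X - a%:P) * s^`()).
rewrite derivM deriv_exp derivXsubC mul1r -subnS mulrnAl -mulrnAr mulrDr.
congr (_ + _); rewrite mulrA -exprSr; congr (_ ^+ _ * _).
by lia.
Qed.

(** Euler's beta integral, with the sign of [(X - 1) ^ b]. *)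
Lemma intp_beta a b : intp ('X^a * ('X - 1%:P) ^+ b) =
  (-1) ^+ b * (a`! * b`!)%:R / (a + b).+1`!%:R.
Proof.
elim: b a => [|b IH] a.
  rewrite expr0 mulr1 intpXn expr0 mul1r fact0 muln1 addn0 factS natrM.
  by rewrite invfM mulrCA mulfV ?mulr1 // pnatr_eq0 -lt0n fact_gt0.
have a1 : a.+1%:R != 0 :> R by rewrite pnatr_eq0.
apply: (mulfI a1); transitivity (- (b.+1%:R * intp ('X^(a.+1) * ('X - 1%:P) ^+ b))).
  have := @intp_parts (('X - 1%:P) ^+ b.+1) 'X^(a.+1).
  rewrite !hornerE /= subrr !expr0n /= !(mulr0, mul0r) => /(_ erefl erefl) parts.
  rewrite derivXn deriv_exp derivXsubC mul1r mulrnAl mulrnAr !intpMn /= in parts.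
  by rewrite (mulrC 'X^a) (mulrC 'X^(a.+1)).
rewrite IH addnS addSn; move: (_^-1) => c.
by rewrite exprS (factS a) (factS b) !natrM; ring.
Qed.

(** The Legendre polynomial of degree [m] on the unit interval, up to a
    constant factor, by the formula of Rodrigues. *)
Definition legendre m : {poly R} := ('X^m * ('X - 1%:P) ^+ m)^`(m).

(** [m] integrations by parts, without boundary terms as 0 and 1 are roots of
    multiplicity [m]. *)
Lemma intp_legendre p m :
  intp (p * legendre m) = (-1) ^+ m * intp (p^`(m) * ('X^m * ('X - 1%:P) ^+ m)).
Proof.
suff H k : (k <= m)%N -> intp (p * legendre m) =
    (-1) ^+ k * intp (p^`(k) * ('X^m * ('X - 1%:P) ^+ m)^`(m - k)).
  by rewrite (H m) // subnn.
elim: k => [|k IH] km; first by rewrite expr0 mul1r subn0.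
rewrite IH 1?ltnW // (_ : m - k = (m - k.+1).+1)%N; last by lia.
have ltm : (m - k.+1 < m)%N by lia.
rewrite derivnS intp_parts.
- by rewrite exprS mulN1r mulNr mulrN.
- have := @derivn_root 0 m _ (('X - 1%:P) ^+ m) ltm.
  by rewrite subr0 hornerM => ->; rewrite mulr0.
- have := @derivn_root 1 m _ 'X^m ltm.
  by rewrite mulrC hornerM => ->; rewrite mulr0.
Qed.

Lemma intp_legendre_lt m k : (k < m)%N -> intp ('X^k * legendre m) = 0.
Proof.
move=> km; rewrite intp_legendre derivn_poly0 ?size_polyXn // mul0r.
by rewrite /intp size_poly0 big_ord0 mulr0.
Qed.

Lemma intp_legendre_eq m :
  intp ('X^m * legendre m) = m`!%:R * (m`!%:R ^+ 2 / (2 * m).+1`!%:R).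
Proof.
rewrite intp_legendre derivnXn subnn ffactnn mulrnAl intpMn expr0 mul1r.
rewrite intp_beta natrM addnn -mul2n; move: (_^-1) => c.
have := sqrr_sign R m; move: (_ ^+ m) (_%:R) => s f s1.
by rewrite -[RHS]mul1r -s1; ring.
Qed.

Lemma coef_XsubC1_exp m k : (('X - 1%:P : {poly R}) ^+ m)`_k =
  (-1) ^+ (m - k) * 'C(m, k)%:R.
Proof.
elim: m k => [|m IH] k.
  by rewrite expr0 coef1 sub0n expr0 mul1r; case: k.
rewrite exprSr mulrBr mulr1 coefB coefMX.
case: k => [|k]; rewrite /= !IH; first by rewrite !subn0 !bin0 sub0r exprS; ring.
rewrite binS natrD subSS.
have [km|mk] := ltnP k m.
  by rewrite (_ : m - k = (m - k.+1).+1)%N ?exprS; [ring | lia].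
by rewrite (@bin_small m k.+1) // mulr0 subr0 add0r.
Qed.

Lemma coef_legendre m k :
  (legendre m)`_k = (-1) ^+ (m - k) * 'C(m, k)%:R * ((m + k) ^_ m)%:R.
Proof.
by rewrite coef_derivn coefXnM ltnNge leq_addr /= addKn coef_XsubC1_exp -[LHS]mulr_natr.
Qed.

Lemma size_legendre m : (size (legendre m) <= m.+1)%N.
Proof.
apply/leq_sizeP => j mj; rewrite coef_legendre bin_small // mulr0 mul0r //.
Qed.

Lemma legendre_lead m : m`!%:R * (legendre m)`_m = (2 * m)`!%:R.
Proof.
rewrite coef_legendre subnn expr0 mul1r binn mul1r -natrM mulnC.
by rewrite mul2n -addnn -(@ffact_fact (m + m) m) ?leq_addr // addnK.
Qed.

Lemma legendre_sublead m : m`!%:R * (legendre m.+1)`_m = - ((2 * m.+1)`!%:R / 2).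
Proof.
rewrite coef_legendre subSnn expr1 binSn -!mulrA !mulN1r mulrN; congr (- _).
have := @ffact_fact (m.+1 + m) m.+1; rewrite leq_addr addKn => /(_ erefl) F.
have -> : (2 * m.+1)`! = ((2 * m.+1) * (m.+1 + m)`!)%N.
  by rewrite (_ : 2 * m.+1 = (m.+1 + m).+1)%N ?factS //; lia.
by rewrite -F !natrM; field.
Qed.

End UnitIntegral.

(** The matrix is the Gram matrix of the monomials [X^i / i!] for the scalar
    product of L2(0, 1). *)
Lemma hilbert_fact_intp (R : realType) n (p : {poly R}) (i : 'I_n) : (size p <= n)%N ->
  \sum_(j < n) hilbert_fact_mx R n i j * (j`!%:R * p`_j) = intp ('X^i * p) / i`!%:R.
Proof.
move=> pn; rewrite -[p in RHS]coefK poly_def mulr_sumr.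
have intp_sum (F : 'I_(size p) -> {poly R}) : intp (\sum_j F j) = \sum_j intp (F j).
  by apply: (big_morph _ (@intpD R)); rewrite /intp size_poly0 big_ord0.
rewrite intp_sum mulr_suml (big_ord_widen n (fun j =>
  intp ('X^i * (p`_j *: 'X^j)) / i`!%:R) pn).
rewrite [LHS](bigID (fun j : 'I_n => (j < size p)%N)) /=.
rewrite [X in _ + X]big1 ?addr0 => [|j]; last first.
  by rewrite -leqNgt => ?; rewrite nth_default // !mulr0.
apply: eq_bigr => j _; have -> : intp ('X^i * (p`_j *: 'X^j)) = p`_j / (i + j).+1%:R.
  by rewrite -scalerAr intpZ -exprD intpXn.
rewrite mxE !natrM addn1; field.
by rewrite -[1]/(1%:R) -!natrD !pnatr_eq0 -!lt0n !fact_gt0.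
Qed.

Lemma hilbert_fact_mx_sym (R : realType) n :
  (hilbert_fact_mx R n)^T = hilbert_fact_mx R n.
Proof.
by apply/matrixP => i j; rewrite !mxE (addnC j) [(j`! * _)%N]mulnC.
Qed.

(** Multiplying by the coefficients of the Legendre polynomials makes the
    matrix triangular, with nonzero diagonal. *)
Lemma hilbert_fact_unit (R : realType) n : hilbert_fact_mx R n \in unitmx.
Proof.
pose L : 'M[R]_n := \matrix_(j, k) (j`!%:R * (legendre R k)`_j).
have HL (i k : 'I_n) : (hilbert_fact_mx R n *m L) i k =
    intp ('X^i * legendre R k) / i`!%:R.
  rewrite -hilbert_fact_intp ?(leq_trans (size_legendre R k)) // mxE.
  by apply: eq_bigr => j _; rewrite [L _ _]mxE.
have : \det (hilbert_fact_mx R n *m L) != 0.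
  rewrite det_trig; last first.
    by apply/is_trig_mxP => i j ij; rewrite HL intp_legendre_lt // mul0r.
  rewrite prodf_seq_neq0; apply/allP => i _; apply/implyP => _.
  rewrite HL intp_legendre_eq !(mulf_neq0, invr_neq0, expf_neq0) //;
    by rewrite pnatr_eq0 -lt0n fact_gt0.
by rewrite det_mulmx mulf_eq0 negb_or unitmxE unitfE => /andP[].
Qed.

(** The Legendre polynomial of degree [m] is orthogonal to all lower degrees,
    so its coefficients are proportional to the last column of the inverse. *)
Lemma invmx_hilbert_last (R : realType) m (k : 'I_m.+1) :
  invmx (hilbert_fact_mx R m.+1) k ord_max =
  (2 * m).+1`!%:R / m`!%:R ^+ 2 * (k`!%:R * (legendre R m)`_k).
Proof.
set g := _ / _; set H := hilbert_fact_mx R m.+1.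
pose l : 'cV[R]_m.+1 := \col_j (g * (j`!%:R * (legendre R m)`_j)).
have m0 : m`!%:R != 0 :> R by rewrite pnatr_eq0 -lt0n fact_gt0.
have m1 : (2 * m).+1`!%:R != 0 :> R by rewrite pnatr_eq0 -lt0n fact_gt0.
suff lE : H *m l = delta_mx ord_max 0.
  transitivity (l k 0); last by rewrite mxE.
  by rewrite -(mulKmx (hilbert_fact_unit R m.+1) l) lE -colE mxE.
apply/matrixP => i j; rewrite !mxE ord1 andbT.
under eq_bigr do rewrite [l _ _]mxE mulrCA.
rewrite -mulr_sumr hilbert_fact_intp ?size_legendre //.
have [->|] := eqVneq i ord_max.
  rewrite intp_legendre_eq /g -[nat_of_ord ord_max]/m -[true%:R]/(1 : R).
  by field; rewrite m0 m1.
rewrite -val_eqE /= => im; rewrite intp_legendre_lt ?mul0r ?mulr0 //.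
by have := ltn_ord i; lia.
Qed.

Lemma invmx_hilbert_corner (R : realType) m :
  invmx (hilbert_fact_mx R m.+1) ord_max ord_max = (kappa R m.+1)^-1.
Proof.
have e0 : (m.+1 - 1 = m)%N by lia.
have e1 : (2 * m.+1 - 1 = (2 * m).+1)%N by lia.
have e2 : (2 * m.+1 - 2 = 2 * m)%N by lia.
rewrite invmx_hilbert_last legendre_lead /kappa e0 e1 e2.
have f0 k : k`!%:R != 0 :> R by rewrite pnatr_eq0 -lt0n fact_gt0.
by field; rewrite !f0.
Qed.

(** The ratio [-1/2] to the corner entry comes from the coefficient of degree
    [m - 1] of the Legendre polynomial of degree [m]. *)
Lemma invmx_hilbert_subcorner (R : realType) m (k : 'I_m.+1) : k.+1 = m ->
  invmx (hilbert_fact_mx R m.+1) k ord_max = - ((kappa R m.+1)^-1 / 2).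
Proof.
move=> km; rewrite -invmx_hilbert_corner !invmx_hilbert_last legendre_lead.
have -> : k`!%:R * (legendre R m)`_k = - ((2 * m)`!%:R / 2).
  by rewrite -[X in legendre R X]km legendre_sublead km.
by rewrite mulrN mulrA.
Qed.

(** This is the leading coefficient of the orthogonal projection of
    [X^m.+1 / m.+1!] on the polynomials of degree at most [m], in the basis
    [X^i / i!]. It is read off the Legendre polynomial of degree [m.+1], which
    is a multiple of the difference between the monomial and its projection. *)
Lemma invmx_hilbert_next (R : realType) m (w : 'cV[R]_m.+1) :
  (forall i, w i 0 = ((i`! * m.+1`! * (i + m + 2))%:R)^-1) ->
  (invmx (hilbert_fact_mx R m.+1) *m w) ord_max 0 = 2^-1.
Proof.
move=> wE; set H := hilbert_fact_mx R m.+1.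
have f0 k : k`!%:R != 0 :> R by rewrite pnatr_eq0 -lt0n fact_gt0.
pose c : 'cV[R]_m.+1 :=
  \col_j (- ((2 * m.+1)`!%:R)^-1 * (j`!%:R * (legendre R m.+1)`_j)).
suff -> : w = H *m c.
  rewrite mulKmx ?hilbert_fact_unit // mxE legendre_sublead.
  by field; rewrite f0.
apply/matrixP => i j; rewrite ord1 wE mxE.
under eq_bigr do rewrite [c _ _]mxE mulrCA.
rewrite -mulr_sumr.
have := @hilbert_fact_intp R m.+2 (legendre R m.+1) (widen_ord (leqnSn _) i).
rewrite size_legendre => /(_ erefl); rewrite big_ord_recr /= legendre_lead.
rewrite intp_legendre_lt ?ltnS ?leq_ord // mul0r.
move/eqP; rewrite addr_eq0 => /eqP.
have -> : \sum_(j0 < m.+1) hilbert_fact_mx R m.+2 (widen_ord (leqnSn m.+1) i)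
    (widen_ord (leqnSn m.+1) j0) * (j0`!%:R * (legendre R m.+1)`_j0) =
    \sum_j0 H i j0 * (j0`!%:R * (legendre R m.+1)`_j0).
  by apply: eq_bigr => k _; rewrite !mxE.
move=> ->; rewrite mulrNN mulrCA mulVf // mulr1 mxE /=; congr (_%:R^-1).
by congr (_ * _)%N; lia.
Qed.

(** * First-order expansions of functions, determinants and inverses *)

Section FirstOrder.
Variable R : realType.
Implicit Types (f g : R -> R) (a b c : R).

Definition expansion1 f a b := exists C : R,
  \forall T \near 0^'+, `|f T - (a + b * T)| <= C * T ^+ 2.

Lemma near0_itv : \forall T \near (0 : R)^'+, 0 < T < 1.
Proof.
near=> T; apply/andP; split; near: T; first exact: nbhs_right_gt.
exact: nbhs_right_lt.
Unshelve. all: by end_near.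
Qed.

Lemma expansion1_eq f g a b : (\forall T \near 0^'+, f T = g T) ->
  expansion1 f a b -> expansion1 g a b.
Proof.
move=> fg [C fC]; exists C; near=> T; have <- : f T = g T by near: T.
by near: T.
Unshelve. all: by end_near. Qed.

Lemma expansion1_cst c : expansion1 (fun=> c) c 0.
Proof. by exists 0; apply: nearW => T; rewrite mul0r addr0 subrr normr0 mul0r. Qed.

Lemma expansion1_id : expansion1 id 0 1.
Proof. by exists 0; apply: nearW => T; rewrite mul1r add0r subrr normr0 mul0r. Qed.

Lemma expansion1_ext f g a b : f =1 g -> expansion1 f a b -> expansion1 g a b.
Proof. by move=> /funext fg; rewrite (_ : g = f). Qed.

Lemma expansion1D f g a b a' b' : expansion1 f a b -> expansion1 g a' b' ->
  expansion1 (fun T => f T + g T) (a + a') (b + b').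
Proof.
move=> [C fC] [D gD]; exists (C + D); near=> T.
rewrite [X in `|X|](_ : _ = (f T - (a + b * T)) + (g T - (a' + b' * T))); last by ring.
by rewrite mulrDl (le_trans (ler_normD _ _)) // lerD //; [near: T | near: T].
Unshelve. all: by end_near. Qed.

Lemma expansion1_bounded f a b : expansion1 f a b ->
  exists2 C, 0 <= C & \forall T \near 0^'+, `|f T| <= C.
Proof.
move=> [C fC]; exists (`|C| + `|a| + `|b|); first by rewrite !addr_ge0.
near=> T; have /andP[T0 T1] : 0 < T < 1 by near: T; exact: near0_itv.
rewrite -(subrK (a + b * T) (f T)) (le_trans (ler_normD _ _)) // -addrA lerD //.
  have : `|f T - (a + b * T)| <= C * T ^+ 2 by near: T.
  move/le_trans; apply; rewrite (le_trans (ler_norm _)) // normrM (ger0_norm (sqr_ge0 T)).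
  by rewrite ler_piMr // exprn_ile1 // ltW.
rewrite (le_trans (ler_normD _ _)) // lerD // normrM (gtr0_norm T0).
by rewrite ler_piMr // ltW.
Unshelve. all: by end_near. Qed.

Lemma expansion1M f g a b a' b' : expansion1 f a b -> expansion1 g a' b' ->
  expansion1 (fun T => f T * g T) (a * a') (a * b' + b * a').
Proof.
move=> ef eg; have [C C0 fC] := expansion1_bounded ef.
case: ef => F fF; case: eg => G gG.
exists (C * G + F * (`|a'| + `|b'|) + `|b * b'|); near=> T.
have /andP[T0 T1] : 0 < T < 1 by near: T; exact: near0_itv.
rewrite [X in `|X|](_ : _ = f T * (g T - (a' + b' * T)) +
  (f T - (a + b * T)) * (a' + b' * T) + (b * b') * T ^+ 2); last by ring.
rewrite [leRHS]mulrDl [X in _ <= X + _]mulrDl; apply: (le_trans (ler_normD _ _)).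
apply: lerD; last first.
  by rewrite normrM (ger0_norm (sqr_ge0 T)).
apply: (le_trans (ler_normD _ _)); apply: lerD.
  by rewrite normrM -[leRHS]mulrA; apply: ler_pM => //; near: T.
rewrite normrM [leRHS]mulrAC; apply: ler_pM => //; first by near: T.
rewrite (le_trans (ler_normD _ _)) // lerD // normrM (gtr0_norm T0).
by rewrite ler_piMr // ltW.
Unshelve. all: by end_near. Qed.

Lemma expansion1Z f a b c : expansion1 f a b ->
  expansion1 (fun T => c * f T) (c * a) (c * b).
Proof. by move=> /(expansion1M (expansion1_cst c)); rewrite mul0r addr0. Qed.

Lemma expansion1B f g a b a' b' : expansion1 f a b -> expansion1 g a' b' ->
  expansion1 (fun T => f T - g T) (a - a') (b - b').
Proof.
move=> ef eg; rewrite -(mulN1r a') -(mulN1r b').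
apply: expansion1_ext (expansion1D ef (expansion1Z (-1) eg)) => T;
  by rewrite mulN1r.
Qed.

Lemma expansion1_sum (I : Type) (s : seq I) (F : I -> R -> R) (a b : I -> R) :
  (forall i, expansion1 (F i) (a i) (b i)) ->
  expansion1 (fun T => \sum_(i <- s) F i T) (\sum_(i <- s) a i) (\sum_(i <- s) b i).
Proof.
move=> eF; elim: s => [|i s IH].
  by rewrite !big_nil; apply: expansion1_ext (expansion1_cst 0) => T; rewrite big_nil.
rewrite !big_cons; apply: expansion1_ext (expansion1D (eF i) IH) => T.
by rewrite big_cons.
Qed.

Lemma expansion1_prod_ex (I : Type) (s : seq I) (P : pred I) (F : I -> R -> R) :
  (forall i, exists a b, expansion1 (F i) a b) ->
  exists a b, expansion1 (fun T => \prod_(i <- s | P i) F i T) a b.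
Proof.
move=> eF; elim: s => [|i s [a [b IH]]].
  exists 1, 0; apply: expansion1_ext (expansion1_cst 1) => T;
  by rewrite big_nil.
have [Pi|NPi] := boolP (P i); last first.
  by exists a, b; apply: expansion1_ext IH => T; rewrite big_cons (negbTE NPi).
have [a' [b' Fi]] := eF i.
do 2!eexists; apply: expansion1_ext (expansion1M Fi IH) => T;
  by rewrite big_cons Pi.
Qed.

Lemma expansion1_prod1 (I : Type) (s : seq I) (F : I -> R -> R) (b : I -> R) :
  (forall i, expansion1 (F i) 1 (b i)) ->
  expansion1 (fun T => \prod_(i <- s) F i T) 1 (\sum_(i <- s) b i).
Proof.
move=> eF; elim: s => [|i s IH].
  by rewrite big_nil; apply: expansion1_ext (expansion1_cst 1) => T; rewrite big_nil.
rewrite big_cons addrC; have := expansion1M (eF i) IH; rewrite !mul1r mulr1.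
by apply: expansion1_ext => T; rewrite big_cons.
Qed.

Lemma expansion1_squeeze f g h a b :
  (\forall T \near 0^'+, f T <= g T <= h T) ->
  expansion1 f a b -> expansion1 h a b -> expansion1 g a b.
Proof.
move=> fgh [C fC] [D hD]; exists (`|C| + `|D|); near=> T.
have T0 : 0 < T by near: T; exact: nbhs_right_gt.
have /andP[fg gh] : f T <= g T <= h T by near: T.
have : `|f T - (a + b * T)| <= C * T ^+ 2 by near: T.
have : `|h T - (a + b * T)| <= D * T ^+ 2 by near: T.
have := sqr_ge0 T; move: (T ^+ 2) => T2 T20.
have C1 := ler_wpM2r T20 (ler_norm C); have D1 := ler_wpM2r T20 (ler_norm D).
have C2 := mulr_ge0 (normr_ge0 C) T20; have D2 := mulr_ge0 (normr_ge0 D) T20.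
rewrite !ler_norml mulrDl => /andP[? ?] /andP[? ?]; apply/andP; split; lra.
Unshelve. all: by end_near. Qed.

Lemma expansion1_near_gt f a b : expansion1 f a b -> a != 0 ->
  \forall T \near 0^'+, `|a| / 2 < `|f T|.
Proof.
move=> [C fC] a0; pose d := `|a| / 2 / (`|b| + `|C| + 1).
have a1 : 0 < `|a| / 2 by rewrite divr_gt0 // normr_gt0.
have s0 : 0 < `|b| + `|C| + 1 by rewrite ltr_wpDl // addr_ge0.
have d0 : 0 < d by rewrite divr_gt0.
near=> T; have /andP[T0 T1] : 0 < T < 1 by near: T; exact: near0_itv.
have Td : T < d by near: T; exact: nbhs_right_lt.
have fT : `|f T - (a + b * T)| <= C * T ^+ 2 by near: T.
have : `|a| <= `|f T| + `|f T - (a + b * T)| + `|b| * T.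
  rewrite [X in `|X| <= _](_ : a = f T - (f T - (a + b * T)) - b * T); last by ring.
  by rewrite (le_trans (ler_normB _ _)) // normrM (gtr0_norm T0) lerD2r ler_normB.
have CT : C * T ^+ 2 <= `|C| * T.
  rewrite (le_trans (ler_norm _)) // normrM (ger0_norm (sqr_ge0 T)) ler_wpM2l //.
  by rewrite expr2 ler_piMr // ltW.
have : T * (`|b| + `|C| + 1) < `|a| / 2 by rewrite -ltr_pdivlMr.
lra.
Unshelve. all: by end_near. Qed.

(** With [g T = a^-1 - b / a^2 T], the product [f g] is [1 + O(T^2)], and
    [1 / f - g = (1 - f g) / f]. *)
Lemma expansion1V f a b : a != 0 -> expansion1 f a b ->
  expansion1 (fun T => (f T)^-1) a^-1 (- b / a ^+ 2).
Proof.
move=> a0 ef; have fa := expansion1_near_gt ef a0.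
have [E eE] : expansion1 (fun T => 1 - f T * (a^-1 + (- b / a ^+ 2) * T)) 0 0.
  have eg : expansion1 (fun T => a^-1 + (- b / a ^+ 2) * T) a^-1 (- b / a ^+ 2).
    by exists 0; apply: nearW => T; rewrite subrr normr0 mul0r.
  have := expansion1B (expansion1_cst 1) (expansion1M ef eg).
  rewrite divff // subrr (_ : 0 - _ = 0) //; by field.
exists (2 / `|a| * E); near=> T.
have fT : `|a| / 2 < `|f T| by near: T.
have a1 : 0 < `|a| / 2 by rewrite divr_gt0 // normr_gt0.
have fT0 : f T != 0 by rewrite -normr_gt0 (lt_trans a1).
rewrite [X in `|X|](_ : _ =
  (f T)^-1 * (1 - f T * (a^-1 + (- b / a ^+ 2) * T))); last first.
  by field; rewrite a0 fT0.
rewrite normrM -[leRHS]mulrA; apply: ler_pM => //.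
  rewrite normfV -[2 / _]invf_div lef_pV2 ?posrE //; first exact: ltW.
  exact: lt_trans a1 fT.
have : `|(1 - f T * (a^-1 + (- b / a ^+ 2) * T)) - (0 + 0 * T)| <= E * T ^+ 2 by near: T.
by rewrite mul0r addr0 subr0.
Unshelve. all: by end_near. Qed.

End FirstOrder.

Section MatrixFirstOrder.
Variables (R : realType) (n : nat).
Implicit Types (M N : R -> 'M[R]_n) (A B : 'M[R]_n).

Definition mx_expansion1 M A B :=
  forall i j, expansion1 (fun T => M T i j) (A i j) (B i j).

Lemma mx_expansion1_cst A : mx_expansion1 (fun=> A) A 0.
Proof. by move=> i j; rewrite mxE; exact: expansion1_cst. Qed.

Lemma mx_expansion1M M N A B A' B' :
  mx_expansion1 M A B -> mx_expansion1 N A' B' ->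
  mx_expansion1 (fun T => M T *m N T) (A *m A') (A *m B' + B *m A').
Proof.
move=> eM eN i j; rewrite !mxE -big_split /=.
apply: expansion1_ext (expansion1_sum _ (fun k => expansion1M (eM i k) (eN k j))).
by move=> T; rewrite mxE.
Qed.

Lemma expansion1_det_ex M A B : mx_expansion1 M A B ->
  exists a b, expansion1 (fun T => \det (M T)) a b.
Proof.
move=> eM.
have eS (s : 'S_n) : exists a b,
    expansion1 (fun T => (-1) ^+ s * \prod_i M T i (s i)) a b.
  have [a [b eP]] : exists a b, expansion1 (fun T => \prod_i M T i (s i)) a b.
    apply: (@expansion1_prod_ex R _ _ xpredT (fun i T => M T i (s i))) => i.
    by do 2!eexists; exact: eM.
  by exists ((-1) ^+ s * a), ((-1) ^+ s * b); exact: expansion1Z.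
have /choice [a] := eS => /choice [b eab].
by exists (\sum_s a s), (\sum_s b s); exact: expansion1_sum.
Qed.

(** In the Leibniz formula a permutation other than the identity displaces two
    indices, hence contributes two off-diagonal factors of order [T]. *)
Lemma expansion1_det1 M B : mx_expansion1 M 1%:M B ->
  expansion1 (fun T => \det (M T)) 1 (\tr B).
Proof.
move=> eM; rewrite -[1]addr0 -[\tr B]addr0.
have -> : (fun T => \det (M T)) = (fun T => \prod_i M T i i +
    \sum_(s : 'S_n | s != 1%g) (-1) ^+ s * \prod_i M T i (s i)).
  apply/funext => T; rewrite /determinant (bigD1 1%g) //= odd_perm1 mul1r.
  by congr (_ + _); apply: eq_bigr => i _; rewrite perm1.
apply: expansion1D.
  by apply: expansion1_prod1 => i; have := eM i i; rewrite mxE eqxx.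
under [X in expansion1 X _ _]funext do rewrite big_mkcond /=.
have z : \sum_(s : 'S_n) 0 = 0 :> R by rewrite big1.
rewrite -[X in expansion1 _ X]z -[X in expansion1 _ _ X]z.
apply: expansion1_sum => s; have [->|s1] := eqVneq s 1%g; first exact: expansion1_cst.
have [i si] : exists i, s i != i.
  apply/existsP; apply: contra_neqT s1 => /existsPn s1.
  by apply/permP => i; rewrite perm1; apply/eqP; have := s1 i; rewrite negbK.
have ssi : s (s i) != s i by rewrite (inj_eq perm_inj).
have [a [b eP]] := @expansion1_prod_ex R _ (index_enum 'I_n)
  (fun k => (k != i) && (k != s i)) (fun k T => M T k (s k))
  (fun k => ex_intro _ _ (ex_intro _ _ (eM k (s k)))).
have ei := eM i (s i); have esi := eM (s i) (s (s i)).
rewrite mxE eq_sym (negbTE si) in ei; rewrite mxE eq_sym (negbTE ssi) in esi.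
have := expansion1Z ((-1) ^+ s) (expansion1M ei (expansion1M esi eP)).
rewrite !(mul0r, mulr0, add0r, addr0); apply: expansion1_ext => T.
by rewrite [in RHS](bigD1 i) //= [in RHS](bigD1 (s i)).
Qed.

(** Normalize the leading matrix to the identity. *)
Lemma expansion1_det M A B : A \in unitmx -> mx_expansion1 M A B ->
  expansion1 (fun T => \det (M T)) (\det A) (\det A * \tr (invmx A *m B)).
Proof.
move=> uA eM; have := mx_expansion1M (mx_expansion1_cst (invmx A)) eM.
rewrite mulVmx // mul0mx addr0 => /expansion1_det1 /(expansion1Z (\det A)).
by rewrite mulr1; apply: expansion1_ext => T; rewrite -det_mulmx mulKVmx.
Qed.

Lemma mx_expansion1_unit M A B : A \in unitmx -> mx_expansion1 M A B ->
  \forall T \near 0^'+, M T \in unitmx.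
Proof.
move=> uA /(expansion1_det uA) eD; have dA : \det A != 0.
  by rewrite -unitfE -unitmxE.
near=> T; rewrite unitmxE unitfE -normr_gt0.
have a0 : 0 < `|\det A| / 2 by rewrite divr_gt0 // normr_gt0.
apply: lt_trans a0 _; near: T; exact: expansion1_near_gt eD _.
Unshelve. all: by end_near. Qed.

End MatrixFirstOrder.

(** The entries of the inverse have some expansion, by the adjugate formula;
    with [X] the inverse and [Y] the claimed expansion, [X = Y + X (1 - M Y)]
    then identifies it, as [1 - M Y] has a zero expansion. *)
Lemma mx_expansion1V (R : realType) n (M : R -> 'M[R]_n) A B :
  A \in unitmx -> mx_expansion1 M A B ->
  mx_expansion1 (fun T => invmx (M T)) (invmx A) (- (invmx A *m B *m invmx A)).
Proof.
move=> uA eM; have uM := mx_expansion1_unit uA eM.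
have dA : \det A != 0 by rewrite -unitfE -unitmxE.
have [X0 [X1 eX]] : exists X0 X1, mx_expansion1 (fun T => invmx (M T)) X0 X1.
  have eE i j : exists a b, expansion1 (fun T => invmx (M T) i j) a b.
    have [a [b eC]] : exists a b, expansion1 (fun T => \det (row' j (col' i (M T)))) a b.
      apply: (@expansion1_det_ex _ _ _ (row' j (col' i A)) (row' j (col' i B))) => k l.
      by rewrite !mxE; apply: expansion1_ext (eM _ _) => T; rewrite !mxE.
    have eV := expansion1V dA (expansion1_det uA eM).
    have eI := expansion1M eV (expansion1Z ((-1) ^+ (j + i)) eC).
    do 2!eexists; apply: expansion1_eq eI; near=> T.
    have uT : M T \in unitmx by near: T.
    by rewrite /invmx uT !mxE.
  have /choice [a] := fun ij => eE ij.1 ij.2 => /choice [b eab].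
  exists (\matrix_(i, j) a (i, j)), (\matrix_(i, j) b (i, j)) => i j.
  by rewrite !mxE; exact: (eab (i, j)).
set Y1 := - (_ *m _ *m _).
pose Y T : 'M[R]_n := invmx A + T *: Y1.
have eY : mx_expansion1 Y (invmx A) Y1.
  move=> i j; have := expansion1D (expansion1_cst (invmx A i j))
    (expansion1Z (Y1 i j) (expansion1_id R)).
  rewrite mulr0 addr0 mulr1 add0r; apply: expansion1_ext => T.
  by rewrite !mxE mulrC.
have eR : mx_expansion1 (fun T => 1%:M - M T *m Y T) 0 0.
  have eMY := mx_expansion1M eM eY => i j.
  have := expansion1B (expansion1_cst ((1%:M : 'M[R]_n) i j)) (eMY i j).
  rewrite mulmxV // subrr /Y1 mulmxN !mulmxA mulmxV // mul1mx addNr.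
  by rewrite !mxE subrr; apply: expansion1_ext => T; rewrite !mxE.
have eXR := mx_expansion1M eX eR => i j.
have := expansion1D (eY i j) (eXR i j).
rewrite !mulmx0 addr0 !mxE !addr0; apply: expansion1_eq; near=> T.
have uT : M T \in unitmx by near: T.
have -> : (invmx (M T) *m (1%:M - M T *m Y T)) i j = invmx (M T) i j - Y T i j.
  by rewrite mulmxBr mulmx1 mulKmx // mxE; congr (_ + _); rewrite mxE.
by rewrite addrC subrK.
Unshelve. all: by end_near. Qed.

(** * The Krylov basis *)

Lemma mulmx_delta (R : realType) p n (M : 'M[R]_(p, n)) i j :
  (M *m delta_mx j (0 : 'I_1)) i 0 = M i j.
Proof. by rewrite -colE mxE. Qed.

Lemma mulmx_exprS (R : realType) n (A : 'M[R]_n) (b : 'cV[R]_n) j :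
  A *m (A ^+ j *m b) = A ^+ j.+1 *m b.
Proof. by rewrite exprS -mulmxA. Qed.

Section Krylov.
Variables (R : realType) (n : nat) (A : 'M[R]_n) (b : 'cV[R]_n).
Hypothesis kalAb : kalman A b.
Let K := krylov_mx A b.

Lemma kalman_unit : K \in unitmx.
Proof. by rewrite -row_free_unit /row_free kalAb. Qed.

Lemma col_krylov_mx (j : 'I_n) : K *m delta_mx j 0 = A ^+ j *m b.
Proof. by rewrite -colE; apply/matrixP => i k; rewrite ord1 !mxE. Qed.

Lemma dotp_sumr (I : Type) (s : seq I) (u : 'cV[R]_n) (F : I -> 'cV[R]_n) :
  dotp u (\sum_(i <- s) F i) = \sum_(i <- s) dotp u (F i).
Proof. by rewrite dotpE mulmx_sumr summxE; apply: eq_bigr => i _; rewrite dotpE. Qed.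

(** The invariant of the process. The last clause makes every residue nonzero:
    it is [K c] for a vector [c] whose [k]-th entry is 1, and [K] is
    invertible. *)
Lemma gram_schmidtP k : (k <= n)%N ->
  [/\ size (gram_schmidt A b k) = k,
      forall i j, (i < k)%N -> (j < k)%N ->
        dotp (gram_schmidt A b k)`_i (gram_schmidt A b k)`_j = (i == j)%:R,
      forall j, (j < k)%N -> A ^+ j *m b =
        \sum_(q <- gram_schmidt A b k) dotp q (A ^+ j *m b) *: q &
      forall q, q \in gram_schmidt A b k ->
        exists2 c, q = K *m c & forall l : 'I_n, (k <= l)%N -> c l 0 = 0].
Proof.
elim: k => [|k IH] kn; first by split.
have [] := IH (ltnW kn); rewrite [gram_schmidt A b k.+1]/=.
set s := gram_schmidt A b k; set w := A ^+ k *m b; set v := w - _ => sz on sp supp.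
have sE (F : 'cV[R]_n -> 'cV[R]_n) : \sum_(q <- s) F q = \sum_(i < k) F s`_i.
  by rewrite (big_nth 0) sz big_mkord.
have vs i : (i < k)%N -> dotp s`_i v = 0.
  move=> ik; rewrite dotpBr sE dotp_sumr (bigD1 (Ordinal ik)) //=.
  rewrite dotpZr on // eqxx mulr1 big1 ?addr0 ?subrr // => j.
  by rewrite -val_eqE /= dotpZr on // => /negbTE ji; rewrite eq_sym ji mulr0.
have /choice [c cP] : forall q, exists c : 'cV[R]_n, q \in s ->
    q = K *m c /\ forall l : 'I_n, (k <= l)%N -> c l 0 = 0.
  move=> q; have [/supp [c qc c0]|] := boolP (q \in s); last by exists 0.
  by exists c.
pose cv : 'cV[R]_n := delta_mx (Ordinal kn) 0 - \sum_(q <- s) dotp q w *: c q.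
have vE : v = K *m cv.
  rewrite mulmxBr col_krylov_mx; congr (_ - _); rewrite mulmx_sumr.
  apply: eq_big_seq => q qs; rewrite -scalemxAr.
  by have [<-] := cP q qs.
have cvl (l : 'I_n) : (k <= l)%N -> cv l 0 = (l == Ordinal kn)%:R.
  move=> kl; rewrite !mxE andbT summxE big_seq big1 ?subr0 // => q qs.
  by have [_ /(_ l kl) cl] := cP q qs; rewrite mxE cl mulr0.
have v0 : v != 0.
  apply/eqP => v0; have : cv = 0 by rewrite -(mulKmx kalman_unit cv) -/K -vE v0 mulmx0.
  move/matrixP/(_ (Ordinal kn) 0)/eqP.
  by rewrite cvl // eqxx mxE oner_eq0.
have q1 := enorm_normalize v0; set q := _ *: v in q1 *.
have qs i : (i < k)%N -> dotp s`_i q = 0 by move=> ik; rewrite dotpZr vs // mulr0.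
have nthE i : (i < k.+1)%N -> (rcons s q)`_i = if (i < k)%N then s`_i else q.
  move=> ik; rewrite nth_rcons sz; have [//|ki] := ltnP i k.
  by rewrite (_ : i == k) // eqn_leq ki -ltnS ik.
split=> [|i j ik jk|j jk|p].
- by rewrite size_rcons sz.
- rewrite !nthE //; case: ltnP => ki; case: ltnP => kj.
  + exact: on.
  + by rewrite qs // (_ : (i == j) = false) //; apply/eqP; lia.
  + by rewrite dotpC qs // (_ : (i == j) = false) //; apply/eqP; lia.
  + by rewrite q1 (_ : i == j) //; apply/eqP; lia.
- rewrite -cats1 big_cat big_seq1 /=.
  have wsum u : dotp q (\sum_(p <- s) dotp p u *: p) = 0.
    rewrite dotp_sumr (big_nth 0) sz big_mkord big1 // => i _.
    by rewrite dotpZr (dotpC q) qs // mulr0.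
  move: jk; rewrite ltnS leq_eqVlt => /orP[/eqP ->|jk].
    have vv : dotp q w *: q = v.
      rewrite (_ : w = v + \sum_(p <- s) dotp p w *: p); last by rewrite subrK.
      rewrite dotpDr wsum addr0 /q dotpZl scalerA mulrAC -expr2 exprVn.
      rewrite sqr_sqrtr ?dotp_ge0 // mulVf ?scale1r // dotp_eq0 //.
    by rewrite -/w vv addrC subrK.
  have : dotp q (A ^+ j *m b) = 0 by rewrite sp // wsum.
  by move=> ->; rewrite scale0r addr0; exact: sp.
- rewrite mem_rcons inE => /orP[/eqP ->|/supp [d -> d0]].
    exists ((enorm v)^-1 *: cv); first by rewrite -scalemxAr -vE.
    move=> l kl; rewrite mxE cvl; last exact: ltnW.
    by rewrite -val_eqE /= gtn_eqF // mulr0.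
  by exists d => // l kl; rewrite d0 // ltnW.
Qed.

End Krylov.

Section LastKrylovVector.
Variables (R : realType) (m : nat) (A : 'M[R]_m.+1) (b : 'cV[R]_m.+1).
Hypothesis kalAb : kalman A b.
Let K := krylov_mx A b.
Let q := krylov_q A b m.+1.
Let d := krylov_d A b m.+1.

Lemma krylov_q_unit : dotp q q = 1.
Proof. by have [_ /(_ m m) -> //] := gram_schmidtP kalAb (leqnn m.+1); rewrite eqxx. Qed.

Lemma krylov_q_orth j : (j < m)%N -> dotp q (A ^+ j *m b) = 0.
Proof.
move=> jm; have [sz _ sp _] := gram_schmidtP kalAb (leqnSn m).
have [_ on _ _] := gram_schmidtP kalAb (leqnn m.+1).
rewrite sp // dotp_sumr (big_nth 0) sz big_mkord big1 // => i _.
rewrite dotpZr; have := on m i; rewrite ltnSn ltnS ltnW // gtn_eqF // => /(_ erefl erefl).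
rewrite [gram_schmidt A b m.+1]/= [in X in dotp _ X]nth_rcons sz ltn_ord => ->.
by rewrite mulr0.
Qed.

(** All that is used of the last vector of the basis besides its norm: it is
    orthogonal to every column of [K] but the last one. *)
Lemma trmx_krylov_q_mul : q^T *m K = d *: delta_mx 0 ord_max.
Proof.
apply/matrixP => i j; rewrite ord1 {i} [RHS]mxE [X in _ = _ * X]mxE eqxx /=.
have -> : (q^T *m K) 0 j = dotp q (A ^+ j *m b).
  by rewrite -col_krylov_mx dotpE mulmxA -colE [RHS]mxE.
have [->|] := eqVneq j ord_max; first by rewrite [RHS]mulr1.
rewrite -val_eqE /= => jm; rewrite krylov_q_orth ?mulr0 //.
by have := ltn_ord j; lia.
Qed.

Lemma krylov_d_neq0 : d != 0.
Proof.
apply/eqP => d0; have := trmx_krylov_q_mul; rewrite d0 scale0r.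
move/(congr1 (mulmx^~ (invmx K))); rewrite mulmxK ?kalman_unit // mul0mx.
move/(congr1 trmx); rewrite trmxK trmx0 => q0.
by have /eqP := krylov_q_unit; rewrite q0 dotpE mulmx0 mxE eq_sym oner_eq0.
Qed.

Lemma invmx_krylov_last j : invmx K ord_max j = q j 0 / d.
Proof.
have := congr1 (mulmx^~ (invmx K)) trmx_krylov_q_mul.
rewrite mulmxK ?kalman_unit // -scalemxAl -rowE => /matrixP /(_ 0 j).
by rewrite !mxE => ->; rewrite mulrAC mulfV ?mul1r // krylov_d_neq0.
Qed.

Lemma invmx_krylov_q_last : (invmx K *m q) ord_max 0 = d^-1.
Proof.
rewrite mxE; under eq_bigr do rewrite invmx_krylov_last mulrAC.
by rewrite -mulr_suml -[X in X / _]/(dotp q q) krylov_q_unit mul1r.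
Qed.

Lemma invmx_krylov_gram_last i :
  (invmx K *m (invmx K)^T) i ord_max = (invmx K *m q) i 0 / d.
Proof.
rewrite !mxE mulr_suml; apply: eq_bigr => k _.
by rewrite mxE invmx_krylov_last mulrA.
Qed.

(** [A] in the basis [b, A b, ...] is a companion matrix: it maps each basis
    vector but the last one to the next. *)
Lemma companion_col (C := invmx K *m A *m K) (i j : 'I_m.+1) :
  (j < m)%N -> C i j = (i == j.+1 :> nat)%:R.
Proof.
move=> jm; have j1 : (j.+1 < m.+1)%N by [].
have -> : C i j = (C *m (delta_mx j 0 : 'cV_m.+1)) i 0 by rewrite mulmx_delta.
rewrite /C -!mulmxA col_krylov_mx mulmx_exprS.
rewrite -[j.+1]/(nat_of_ord (Ordinal j1)) -col_krylov_mx mulKmx ?kalman_unit //.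
by rewrite mxE andbT.
Qed.

Lemma companion_diag (C := invmx K *m A *m K) j :
  C j j = (j == ord_max)%:R * \tr A.
Proof.
have C0 (k : 'I_m.+1) : k != ord_max -> C k k = 0.
  rewrite -val_eqE /= => km; rewrite companion_col; last by have := ltn_ord k; lia.
  by rewrite (ltn_eqF (ltnSn k)).
have [->|jm] := eqVneq j ord_max; last by rewrite C0 // mul0r.
rewrite mul1r -(mulKVmx (kalman_unit kalAb) A) -/K mxtrace_mulC -/C.
by rewrite /mxtrace (bigD1 ord_max) //= big1 ?addr0 // => k; exact: C0.
Qed.

(** In the basis [b, A b, ...], pairing with the last Krylov vector selects the
    last row of the companion matrix. Of this row, the diagonal entry is the
    trace, the entry next to it is 1, and the coordinate of the Krylov vector
    that the diagonal entry meets is [d^-1]. *)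
Lemma krylov_aE (xi := invmx K *m q) : krylov_a A b m.+1 =
  \tr A + d * \sum_(j < m.+1 | j.+1 == m) xi j 0.
Proof.
pose C := invmx K *m A *m K.
have -> : krylov_a A b m.+1 = (d *: delta_mx (0 : 'I_1) ord_max *m (C *m xi)) 0 0.
  rewrite -trmx_krylov_q_mul /C /xi -!mulmxA (mulKVmx (kalman_unit kalAb)) -/K.
  by rewrite (mulKVmx (kalman_unit kalAb)) /krylov_a dotpE.
rewrite -scalemxAl -rowE mxE [X in _ * X]mxE [X in _ * X]mxE.
rewrite (bigD1 ord_max) //= -/C companion_diag eqxx mul1r -/xi invmx_krylov_q_last.
rewrite mulrDr; congr (_ + _); first by rewrite mulrCA mulfV ?mulr1 // krylov_d_neq0.
congr (_ * _); rewrite big_mkcond [RHS]big_mkcond; apply: eq_bigr => j _.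
have := ltn_ord j; rewrite -val_eqE /= ltnS leq_eqVlt => /orP[/eqP jm|jm].
  by rewrite jm eqxx /= gtn_eqF.
rewrite ltn_eqF //= companion_col //= eq_sym.
by case: eqP => _; rewrite ?mul1r ?mul0r.
Qed.

End LastKrylovVector.

Lemma krylov_q1 (R : realType) n (A : 'M[R]_n) b : krylov_q A b 1 = (enorm b)^-1 *: b.
Proof. by rewrite /krylov_q /= big_nil subr0 expr0 mul1mx. Qed.

(** * The matrix exponential *)

Section EntireSeries.
Variable R : realType.
Implicit Types (a : nat -> R) (t : R).

(** Coefficients of the order of those of the exponential: the power series
    converges everywhere, and the class is stable under termwise
    differentiation. *)
Definition exp_bounded a := exists c D : R, [/\ 0 <= c, 0 <= D &
  forall k, `|a k| <= D * (c ^+ k / k`!%:R)].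

Definition psum a t : R := limn (pseries a t).

Lemma exp_bounded_norm_cvg a t : exp_bounded a ->
  cvgn (series (fun k => `|a k * t ^+ k|)).
Proof.
move=> [c [D [c0 D0 aD]]].
apply: (@series_le_cvg _ _ (fun k => D * exp_coeff (c * `|t|) k)) => [k //|k|k|].
- by rewrite mulr_ge0 // exp_coeff_ge0 // mulr_ge0.
- rewrite [leRHS](_ : _ = D * (c ^+ k / k`!%:R) * `|t| ^+ k).
    by rewrite normrM normrX; apply: ler_wpM2r => //; rewrite exprn_ge0.
  by rewrite /exp_coeff /= exprMn; ring.
- rewrite (_ : series _ = fun n => D * series (exp_coeff (c * `|t|)) n).
    by apply: cvgP; apply: cvgMl_tmp; exact: is_cvg_series_exp_coeff.
  by apply/funext => n; rewrite /series /= mulr_sumr.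
Qed.

Lemma exp_bounded_cvg a t : exp_bounded a -> cvgn (pseries a t).
Proof. by move=> aD; apply: normed_cvg; exact: exp_bounded_norm_cvg. Qed.

Lemma exp_bounded_diffs a : exp_bounded a -> exp_bounded (pseries_diffs a).
Proof.
move=> [c [D [c0 D0 aD]]]; exists c, (D * c); split=> // [|k]; first exact: mulr_ge0.
rewrite /pseries_diffs normrM ger0_norm //.
apply: le_trans (ler_wpM2l (ler0n _ _) (aD k.+1)) _.
rewrite factS natrM exprS le_eqVlt; apply/orP; left; apply/eqP; field.
by rewrite -[1]/(1%:R) -natrD !pnatr_eq0 -lt0n fact_gt0.
Qed.

Lemma exp_bounded_sum (I : Type) (s : seq I) (w : I -> R) (a : I -> nat -> R) :
  (forall i, exp_bounded (a i)) ->
  exp_bounded (fun k => \sum_(i <- s) w i * a i k).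
Proof.
move=> aD; elim: s => [|i s [c [D [c0 D0 IH]]]].
  by exists 0, 0; split=> // k; rewrite big_nil normr0 mul0r.
have [c' [D' [c'0 D'0 ia]]] := aD i.
exists (c + c'), (D + `|w i| * D'); split=> [||k].
- exact: addr_ge0.
- by rewrite addr_ge0 // mulr_ge0.
- rewrite big_cons addrC mulrDl (le_trans (ler_normD _ _)) // lerD //.
    apply: le_trans (IH k) _; apply: ler_wpM2l => //; apply: ler_wpM2r => //.
    by rewrite lerXn2r // ?nnegrE ?addr_ge0 // lerDl.
  rewrite normrM -mulrA; apply: ler_wpM2l => //; apply: le_trans (ia k) _.
  apply: ler_wpM2l => //; apply: ler_wpM2r => //.
  by rewrite lerXn2r // ?nnegrE ?addr_ge0 // lerDr.
Qed.

Lemma psum_sum (I : Type) (s : seq I) (w : I -> R) (a : I -> nat -> R) t :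
  (forall i, exp_bounded (a i)) ->
  psum (fun k => \sum_(i <- s) w i * a i k) t = \sum_(i <- s) w i * psum (a i) t.
Proof.
move=> aD; apply: cvg_lim => //; elim: s => [|i s IH].
  rewrite big_nil [X in X @ _ --> _](_ : _ = fun=> 0); first exact: cvg_cst.
  by apply/funext => n; rewrite /pseries /series /= big1 // => k _; rewrite big_nil mul0r.
rewrite big_cons [X in X @ _ --> _](_ : _ = fun n => w i * pseries (a i) t n +
    pseries (fun k => \sum_(j <- s) w j * a j k) t n).
  by apply: cvgD => //; apply: cvgMl_tmp; exact: exp_bounded_cvg.
apply/funext => n; rewrite /pseries /series /= mulr_sumr -big_split /=.
by apply: eq_bigr => k _; rewrite big_cons mulrDl mulrA.
Qed.

Lemma is_derive_psum a t : exp_bounded a ->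
  is_derive t (1 : R) (psum a) (psum (pseries_diffs a) t).
Proof.
move=> aD; have t1 : `|t| < `|(`|t| + 1)| by rewrite [ltRHS]ger0_norm ?ltrDl ?addr_ge0.
apply: (pseries_snd_diffs _ _ _ t1); apply: exp_bounded_cvg => //.
  exact: exp_bounded_diffs.
by do 2!apply: exp_bounded_diffs.
Qed.

(** The sum of the moduli of the coefficients bounds every tail on [0, 1]. *)
Lemma psum_tail a N : exp_bounded a -> exists2 C, 0 <= C &
  forall t, 0 <= t <= 1 -> `|psum a t - \sum_(k < N) a k * t ^+ k| <= C * t ^+ N.
Proof.
move=> aD; have aC := @exp_bounded_norm_cvg a 1 aD.
pose C := limn (series (fun k => `|a k * 1 ^+ k|)).
have C0 n : series (fun k => `|a k * 1 ^+ k|) n <= C.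
  apply: nondecreasing_cvgn_le => //; apply: nondecreasing_series => k _ _.
  exact: normr_ge0.
exists C; first by rewrite (le_trans _ (C0 0)) // /series /= big_geq.
move=> t /andP[t0 t1]; have tC := @exp_bounded_cvg a t aD.
have tN : `|pseries a t n - \sum_(k < N) a k * t ^+ k| @[n --> \oo] -->
    `|psum a t - \sum_(k < N) a k * t ^+ k|.
  by apply: cvg_norm; apply: cvgB => //; exact: cvg_cst.
rewrite -(cvg_lim _ tN) //; apply: limr_le; first exact: cvgP tN.
near=> n; have Nn : (N <= n)%N by near: n; exact: nbhs_infty_ge.
rewrite -(big_mkord xpredT (fun k => a k * t ^+ k)) /pseries.
rewrite -[X in _ - X]/(series (fun k => a k * t ^+ k) N) sub_series_geq //.
apply: le_trans (ler_norm_sum _ _ _) _.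
apply: (@le_trans _ _ (\sum_(N <= k < n) `|a k * 1 ^+ k| * t ^+ N)).
  apply: ler_sum_nat => k /andP[Nk _].
  rewrite expr1n mulr1 normrM ler_wpM2l // normrX ger0_norm //.
  by rewrite ler_wiXn2l.
rewrite -mulr_suml; apply: ler_wpM2r; first exact: exprn_ge0.
rewrite -sub_series_geq // (le_trans _ (C0 n)) // lerBlDr lerDl.
by apply: sumr_ge0 => k _.
Unshelve. all: by end_near. Qed.

End EntireSeries.

Section MatrixExponential.
Variables (R : realType) (n : nat).
Implicit Types (A M : 'M[R]_n) (z : 'rV[R]_n) (c : 'cV[R]_n).

Lemma cvg_mx (U : nat -> 'M[R]_n) M :
  (forall i j, U k i j @[k --> \oo] --> M i j) -> U @ \oo --> M.
Proof.
move=> UM S [P nP sPS].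
have : \forall k \near \oo, forall i j, P i j (U k i j).
  apply: filter_forall => i; apply: filter_forall => j.
  exact: UM i j _ (nP i j).
by apply: filterS => k Pk; apply: sPS => i j; exact: Pk.
Qed.

Lemma exprZmx A t k : (t *: A) ^+ k = t ^+ k *: A ^+ k.
Proof.
elim: k => [|k IH]; first by rewrite !expr0 scale1r.
by rewrite !exprS IH -[LHS]scalemxAl -scalemxAr scalerA.
Qed.

Definition expmx_coef A i j k : R := (A ^+ k) i j / k`!%:R.

Lemma exp_bounded_expmx_coef A i j : exp_bounded (expmx_coef A i j).
Proof.
pose c := 1 + \sum_i \sum_j `|A i j|.
have S0 : 0 <= \sum_i \sum_j `|A i j| by do 2!apply: sumr_ge0 => ? _.
have c0 : 0 <= c by rewrite addr_ge0.
suff cA k p q : `|(A ^+ k) p q| <= c ^+ k.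
  exists c, 1; split=> // k; rewrite mul1r normrM normfV (ger0_norm (ler0n _ _)).
  by apply: ler_wpM2r.
elim: k p q => [|k IH] p q.
  by rewrite !expr0 mxE; case: eqP => _; rewrite ?normr1 ?normr0.
rewrite exprS mxE exprS; apply: le_trans (ler_norm_sum _ _ _) _.
apply: (@le_trans _ _ ((\sum_j `|A p j|) * c ^+ k)).
  by rewrite mulr_suml; apply: ler_sum => l _; rewrite normrM ler_wpM2l.
apply: ler_wpM2r; first exact: exprn_ge0.
rewrite /c [X in _ <= _ + X](bigD1 p) //= addrCA lerDl addr_ge0 //.
by do 2!apply: sumr_ge0 => ? _.
Qed.

Lemma expmxE A t i j : expmx (t *: A) i j = psum (expmx_coef A i j) t.
Proof.
suff /(cvg_lim (@norm_hausdorff _ _)) lE :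
    series (fun k : nat => (k`!%:R)^-1 *: (t *: A) ^+ k) @ \oo -->
    (\matrix_(i, j) psum (expmx_coef A i j) t : 'M[R]_n).
  by rewrite /expmx lE mxE.
apply: cvg_mx => p q; rewrite mxE.
rewrite [X in X @ _ --> _](_ : _ = pseries (expmx_coef A p q) t).
  by apply: exp_bounded_cvg; exact: exp_bounded_expmx_coef.
apply/funext => N; rewrite /pseries /series /= summxE; apply: eq_bigr => k _.
rewrite mxE exprZmx mxE /expmx_coef; ring.
Qed.

(** Every function of time below, such as the coordinates of [e^{tA} b] and the
    optimal control, is of this form, which reduces the matrix exponential to
    scalar power series. *)
Definition expmx_pair A z c t : R := (z *m expmx (t *: A) *m c) 0 0.

Definition pair_coef A z c k : R := (z *m A ^+ k *m c) 0 0 / k`!%:R.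

Lemma pair_coef_sum A z c : pair_coef A z c =
  (fun k => \sum_(ij : 'I_n * 'I_n) z 0 ij.1 * c ij.2 0 * expmx_coef A ij.1 ij.2 k).
Proof.
apply/funext => k; rewrite /pair_coef mxE mulr_suml.
under eq_bigr do rewrite mxE 2!mulr_suml.
rewrite exchange_big pair_big /=; apply: eq_bigr => -[i j] _ /=.
rewrite /expmx_coef; ring.
Qed.

Lemma exp_bounded_pair_coef A z c : exp_bounded (pair_coef A z c).
Proof.
rewrite pair_coef_sum; apply: exp_bounded_sum => ij.
exact: exp_bounded_expmx_coef.
Qed.

Lemma expmx_pairE A z c t : expmx_pair A z c t = psum (pair_coef A z c) t.
Proof.
rewrite pair_coef_sum psum_sum => [|ij]; last exact: exp_bounded_expmx_coef.
rewrite /expmx_pair mxE; under eq_bigr do rewrite mxE mulr_suml.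
rewrite exchange_big pair_big /=; apply: eq_bigr => -[i j] _ /=.
by rewrite expmxE mulrAC.
Qed.

Lemma is_derive_expmx_pair A z c t :
  is_derive t (1 : R) (expmx_pair A z c) (expmx_pair A (z *m A) c t).
Proof.
rewrite (_ : expmx_pair A z c = psum (pair_coef A z c)); last first.
  by apply/funext => s; exact: expmx_pairE.
have := is_derive_psum t (exp_bounded_pair_coef A z c).
rewrite expmx_pairE (_ : pseries_diffs _ = pair_coef A (z *m A) c) //.
apply/funext => k; rewrite /pseries_diffs /pair_coef exprS -!mulmxA factS natrM.
field.
by rewrite -[1]/(1%:R) -natrD !pnatr_eq0 -lt0n fact_gt0.
Qed.

Lemma expmx_pair_mulA A z c t : expmx_pair A (z *m A) c t = expmx_pair A z (A *m c) t.
Proof.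
rewrite !expmx_pairE; congr psum; apply/funext => k.
have AC : A *m A ^+ k = A ^+ k *m A by exact: etrans (esym (exprS A k)) (exprSr A k).
by rewrite /pair_coef -!mulmxA (mulmxA A) AC -mulmxA.
Qed.

Lemma expmx_pair_tail A z c N : exists2 C, 0 <= C & forall t, 0 <= t <= 1 ->
  `|expmx_pair A z c t -
    \sum_(k < N) (z *m A ^+ k *m c) 0 0 / k`!%:R * t ^+ k| <= C * t ^+ N.
Proof.
have [C C0 tl] := psum_tail N (exp_bounded_pair_coef A z c).
by exists C => // t t01; rewrite expmx_pairE; exact: tl.
Qed.

Lemma expmx_pair0 A z c : expmx_pair A z c 0 = (z *m c) 0 0.
Proof.
have [C _ /(_ 0)] := expmx_pair_tail A z c 1.
rewrite lexx ler01 expr1 mulr0 normr_le0 big_ord_recl big_ord0 expr0 => /(_ erefl).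
by rewrite fact0 divr1 mulr1 addr0 ?expr0 mulmx1 subr_eq0 => /eqP.
Qed.

Lemma expmx_trmx A t : expmx (t *: A^T) = (expmx (t *: A))^T.
Proof.
apply/matrixP => i j; rewrite mxE !expmxE; congr psum; apply/funext => k.
suff AT : A^T ^+ k = (A ^+ k)^T by rewrite /expmx_coef AT mxE.
elim: k => [|k IH]; first by rewrite !expr0 trmx1.
by rewrite exprS exprSr IH; exact: esym (trmx_mul _ _).
Qed.

End MatrixExponential.

(** * Integrals of functions with an expansion *)

Section IntegralCalculus.
Variable R : realType.
Implicit Types (f g F : R -> R) (a b T : R).
Notation mu := (@lebesgue_measure R).
Notation integrable_on a b f := (mu.-integrable `[a, b]%classic (EFin \o f)).

Lemma continuous_integrable_on f a b : continuous f -> integrable_on a b f.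
Proof.
move=> cf; apply: continuous_compact_integrable; first exact: segment_compact.
exact: continuous_subspaceT.
Qed.

Lemma is_derive_continuous F f : (forall t, is_derive t (1 : R) F (f t)) ->
  continuous F.
Proof.
move=> dF t; apply: differentiable_continuous; apply/derivable1_diffP.
exact: ex_derive.
Qed.

Lemma Rintegral_FTC F f a b : a <= b -> continuous f ->
  (forall t, is_derive t (1 : R) F (f t)) ->
  \int[mu]_(x in `[a, b]) f x = F b - F a.
Proof.
move=> ab cf dF; have cF := is_derive_continuous dF.
move: ab; rewrite le_eqVlt => /predU1P[->|ab].
  by rewrite set_itv1 Rintegral_set1 subrr.
rewrite /Rintegral (@continuous_FTC2 _ f F) // ?fineB //.
- exact: continuous_subspaceT.
- split=> [t _||].
  + exact: ex_derive.
  + exact/cvg_at_right_filter/cF.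
  + exact/cvg_at_left_filter/cF.
- by move=> t _; rewrite derive1E; apply: derive_val.
Qed.

Lemma integrable_on_sum (I : Type) (s : seq I) (h : I -> R -> R) a b :
  (forall i, integrable_on a b (h i)) ->
  integrable_on a b (fun x => \sum_(i <- s) h i x).
Proof.
move=> ih.
apply: (@eq_integrable _ _ _ mu _ _ (fun x => \sum_(i <- s) (h i x)%:E)%E) => //.
  by move=> x _; rewrite sumEFin.
by apply: integrable_sum => // i _; exact: ih.
Qed.

Lemma Rintegral_sum (I : Type) (s : seq I) (h : I -> R -> R) a b :
  (forall i, integrable_on a b (h i)) ->
  \int[mu]_(x in `[a, b]) (\sum_(i <- s) h i x) =
  \sum_(i <- s) \int[mu]_(x in `[a, b]) h i x.
Proof.
move=> ih; elim: s => [|i s IH].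
  by under eq_Rintegral do rewrite big_nil; rewrite Rintegral_cst // mul0r big_nil.
under eq_Rintegral do rewrite big_cons.
by rewrite RintegralD // ?big_cons ?IH //; exact: integrable_on_sum.
Qed.

Lemma continuous_exprn k : continuous (fun x : R => x ^+ k).
Proof. by move=> x; exact: exprn_continuous. Qed.

Lemma Rintegral_exprn k T : 0 <= T ->
  \int[mu]_(x in `[0, T]) x ^+ k = T ^+ k.+1 / k.+1%:R.
Proof.
move=> T0; have k1 : k.+1%:R != 0 :> R by rewrite pnatr_eq0.
have dF t : is_derive t (1 : R) (fun x => k.+1%:R^-1 * x ^+ k.+1) (t ^+ k).
  rewrite (_ : (fun _ => _) = k.+1%:R^-1 \*: (id ^+ k.+1)); last first.
    by apply/funext => x; rewrite exprfctE.
  apply: is_derive_eq; rewrite /GRing.scale /= mulr1 mulrA mulVf ?mul1r //.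
rewrite (Rintegral_FTC T0 (@continuous_exprn k) dF).
by rewrite expr0n mulr0 subr0 mulrC.
Qed.

Lemma expansion1_integral f k a b (C : R) : continuous f ->
  (forall t : R, 0 <= t <= 1 -> `|f t - (a * t ^+ k + b * t ^+ k.+1)| <= C * t ^+ k.+2) ->
  expansion1 (fun T => \int[mu]_(t in `[0, T]) f t / T ^+ k.+1)
    (a / k.+1%:R) (b / k.+2%:R).
Proof.
move=> cf fC; exists (C / k.+3%:R); near=> T.
have /andP[T0 T1] : 0 < T < 1 by near: T; exact: near0_itv.
have cg : continuous (fun t : R => a * t ^+ k + b * t ^+ k.+1).
  move=> t; apply: cvgD; apply: cvgMl_tmp; exact: exprn_continuous.
have Ig : \int[mu]_(t in `[0, T]) (a * t ^+ k + b * t ^+ k.+1) =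
    a * (T ^+ k.+1 / k.+1%:R) + b * (T ^+ k.+2 / k.+2%:R).
  rewrite RintegralD //; first last.
  - by apply: continuous_integrable_on => t; apply: cvgMl_tmp; exact: exprn_continuous.
  - by apply: continuous_integrable_on => t; apply: cvgMl_tmp; exact: exprn_continuous.
  by rewrite !RintegralZl ?Rintegral_exprn ?ltW //; apply: continuous_integrable_on;
    exact: continuous_exprn.
have Tk : 0 < T ^+ k.+1 by rewrite exprn_gt0.
have -> : \int[mu]_(t in `[0, T]) f t / T ^+ k.+1 - (a / k.+1%:R + b / k.+2%:R * T) =
    (\int[mu]_(t in `[0, T]) (f t - (a * t ^+ k + b * t ^+ k.+1))) / T ^+ k.+1.
  rewrite RintegralB //; try exact: continuous_integrable_on.
  rewrite Ig !exprS; field.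
  by rewrite !gt_eqF ?exprn_gt0 //; have := ler0n R k; lra.
rewrite normrM normfV (gtr0_norm Tk) ler_pdivrMr //.
have -> : C / k.+3%:R * T ^+ 2 * T ^+ k.+1 = \int[mu]_(t in `[0, T]) (C * t ^+ k.+2).
  rewrite RintegralZl ?Rintegral_exprn ?ltW //.
    by rewrite -mulrA -exprD mulrA mulrAC.
  by apply: continuous_integrable_on; exact: continuous_exprn.
apply: le_trans (le_normr_Rintegral _ _) _ => //.
  by apply: continuous_integrable_on => t; apply: cvgB; [exact: cf | exact: cg].
apply: le_Rintegral => //.
- apply: continuous_integrable_on => t; apply: cvg_norm.
  by apply: cvgB; [exact: cf | exact: cg].
- by apply: continuous_integrable_on => t; apply: cvgMl_tmp; exact: exprn_continuous.
- move=> t /=; rewrite in_itv /= => /andP[t0 tT]; apply: fC.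
  by rewrite t0 (le_trans tT) // ltW.
Unshelve. all: by end_near. Qed.

End IntegralCalculus.

(** * The Gramian as a quadratic form *)

Section Gramian.
Variables (R : realType) (n : nat) (A : 'M[R]_n) (b : 'cV[R]_n).
Notation mu := (@lebesgue_measure R).
Notation G := (gramian A b).
Implicit Types z : 'rV[R]_n.

Lemma continuous_expmx_pair z (c : 'cV[R]_n) : continuous (expmx_pair A z c).
Proof. exact: is_derive_continuous (is_derive_expmx_pair A z c). Qed.

Lemma continuous_mul (f g : R -> R) : continuous f -> continuous g ->
  continuous (fun t => f t * g t).
Proof. by move=> cf cg t; apply: cvgM; [exact: cf | exact: cg]. Qed.

Lemma gramian_entry T i j : G T i j = \int[mu]_(t in `[0, T])
  (expmx_pair A (delta_mx 0 i) b t * expmx_pair A (delta_mx 0 j) b t).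
Proof.
rewrite mxE; apply: eq_Rintegral => t _.
rewrite expmx_trmx -mulmxA -trmx_mul mxE big_ord1; congr (_ * _).
  by rewrite /expmx_pair -mulmxA -rowE [RHS]mxE.
by rewrite mxE /expmx_pair -mulmxA -rowE [RHS]mxE.
Qed.

Lemma expmx_pair_row z (c : 'cV[R]_n) t :
  expmx_pair A z c t = \sum_i z 0 i * expmx_pair A (delta_mx 0 i) c t.
Proof.
rewrite {1}/expmx_pair -mulmxA mxE; apply: eq_bigr => i _.
by rewrite /expmx_pair -[in RHS]mulmxA -rowE [X in _ = _ * X]mxE.
Qed.

(** The Gramian is the matrix of the form that integrates the product of two
    coordinates of the free trajectory [e^{tA} b]. *)
Lemma gramian_form z1 z2 T : (z1 *m G T *m z2^T) 0 0 =
  \int[mu]_(t in `[0, T]) (expmx_pair A z1 b t * expmx_pair A z2 b t).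
Proof.
pose v i := expmx_pair A (delta_mx 0 i) b.
have cv i j : continuous (fun t => v i t * v j t).
  by apply: continuous_mul; exact: continuous_expmx_pair.
under eq_Rintegral => t _.
  rewrite expmx_pair_row (expmx_pair_row z2) mulr_suml.
  under eq_bigr => i _.
    rewrite mulr_sumr.
    under eq_bigr => j _ do rewrite mulrACA -/(v i t) -/(v j t).
  over.
over.
have cz i j : continuous (fun t => z1 0 i * z2 0 j * (v i t * v j t)).
  by move=> t; apply: cvgMl_tmp; exact: cv.
rewrite Rintegral_sum => [|i]; last first.
  by apply: integrable_on_sum => j; exact: continuous_integrable_on.
rewrite -mulmxA mxE; apply: eq_bigr => i _.
rewrite Rintegral_sum => [|j]; last exact: continuous_integrable_on.
rewrite mxE mulr_sumr; apply: eq_bigr => j _.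
rewrite RintegralZl //; last exact: continuous_integrable_on.
by rewrite -gramian_entry [z2^T _ _]mxE; ring.
Qed.

Lemma gramian_sym T : (G T)^T = G T.
Proof.
apply/matrixP => i j; rewrite mxE !gramian_entry.
by under eq_Rintegral do rewrite mulrC.
Qed.

Lemma gramian_psd T (u : 'cV[R]_n) : 0 <= dotp u (G T *m u).
Proof.
rewrite dotpE -{2}(trmxK u) mulmxA gramian_form.
by apply: Rintegral_ge0 => t _; rewrite -expr2 sqr_ge0.
Qed.

Lemma expmx_pair_expand z j : (forall k, (k < j)%N -> (z *m A ^+ k *m b) 0 0 = 0) ->
  exists2 C, 0 <= C & forall t, 0 <= t <= 1 ->
   `|expmx_pair A z b t - ((z *m A ^+ j *m b) 0 0 / j`!%:R * t ^+ j +
     (z *m A ^+ j.+1 *m b) 0 0 / j.+1`!%:R * t ^+ j.+1)| <= C * t ^+ j.+2.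
Proof.
move=> z0; have [C C0 tl] := expmx_pair_tail A z b j.+2.
exists C => // t /tl; rewrite !big_ord_recr /= big1 ?add0r // => i _.
by rewrite z0 // !mul0r.
Qed.

Lemma product_expand (f g : R -> R) i j a a' c c' (C C' : R) : 0 <= C -> 0 <= C' ->
  (forall t, 0 <= t <= 1 -> `|f t - (a * t ^+ i + c * t ^+ i.+1)| <= C * t ^+ i.+2) ->
  (forall t, 0 <= t <= 1 -> `|g t - (a' * t ^+ j + c' * t ^+ j.+1)| <= C' * t ^+ j.+2) ->
  exists D : R, forall t, 0 <= t <= 1 ->
   `|f t * g t - (a * a' * t ^+ (i + j) + (a * c' + c * a') * t ^+ (i + j).+1)|
     <= D * t ^+ (i + j).+2.
Proof.
move=> C0 C'0 fC gC.
exists (`|c * c'| + C * (`|a'| + `|c'| + C') + (`|a| + `|c|) * C').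
move=> t /[dup] t01 /andP[t0 t1].
have tX k : 0 <= t ^+ k by rewrite exprn_ge0.
have tX1 k : t ^+ k <= 1 by rewrite exprn_ile1.
have pB (x y : R) k : `|x * t ^+ k + y * t ^+ k.+1| <= (`|x| + `|y|) * t ^+ k.
  rewrite mulrDl (le_trans (ler_normD _ _)) // !normrM !(ger0_norm (tX _)) lerD2l.
  by rewrite ler_wpM2l // exprS ler_piMl.
have gB : `|g t| <= (`|a'| + `|c'| + C') * t ^+ j.
  rewrite -(subrK (a' * t ^+ j + c' * t ^+ j.+1) (g t)) (le_trans (ler_normD _ _)) //.
  rewrite addrC [leRHS]mulrDl lerD ?pB // (le_trans (gC _ t01)) // ler_wpM2l //.
  by rewrite !exprS mulrA ler_piMl // mulr_ile1.
rewrite [X in `|X|](_ : _ = c * c' * t ^+ (i + j).+2 +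
  (f t - (a * t ^+ i + c * t ^+ i.+1)) * g t +
  (a * t ^+ i + c * t ^+ i.+1) * (g t - (a' * t ^+ j + c' * t ^+ j.+1))); last first.
  by rewrite !exprS exprD; ring.
rewrite [leRHS]mulrDl [X in _ <= X + _]mulrDl.
apply: le_trans (ler_normD _ _) _; apply: lerD.
  apply: le_trans (ler_normD _ _) _; apply: lerD.
    by rewrite normrM (ger0_norm (tX _)).
  rewrite normrM; apply: le_trans (ler_pM _ _ (fC t t01) gB) _ => //.
  by rewrite le_eqVlt; apply/orP; left; apply/eqP; rewrite !exprS exprD; ring.
rewrite normrM; apply: le_trans (ler_pM _ _ (pB _ _ _) (gC t t01)) _ => //.
by rewrite le_eqVlt; apply/orP; left; apply/eqP; rewrite !exprS exprD; ring.
Qed.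

(** When the coordinates [z1 e^{tA} b] and [z2 e^{tA} b] vanish to the orders
    [i] and [j] at 0, their integrated product is of order [i + j + 1], and two
    Taylor coefficients of each coordinate determine its first correction. *)
Lemma expansion1_gramian_form z1 z2 i j :
  (forall k, (k < i)%N -> (z1 *m A ^+ k *m b) 0 0 = 0) ->
  (forall k, (k < j)%N -> (z2 *m A ^+ k *m b) 0 0 = 0) ->
  let a k := (z1 *m A ^+ k *m b) 0 0 / k`!%:R in
  let a' k := (z2 *m A ^+ k *m b) 0 0 / k`!%:R in
  expansion1 (fun T => (z1 *m G T *m z2^T) 0 0 / T ^+ (i + j).+1)
    (a i * a' j / (i + j).+1%:R) ((a i * a' j.+1 + a i.+1 * a' j) / (i + j).+2%:R).
Proof.
move=> /expmx_pair_expand[C C0 fC] /expmx_pair_expand[C' C'0 gC] a a'.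
have [D fgD] := product_expand C0 C'0 fC gC.
apply: expansion1_ext (expansion1_integral _ fgD).
  by move=> T; rewrite gramian_form.
by apply: continuous_mul; exact: continuous_expmx_pair.
Qed.

End Gramian.

(** * The scaled Gramian *)

Section ScaledGramian.
Variables (R : realType) (m : nat) (A : 'M[R]_m.+1) (b : 'cV[R]_m.+1).
Hypothesis kalAb : kalman A b.
Let K := krylov_mx A b.
Notation G := (gramian A b).
Notation H := (hilbert_fact_mx R m.+1).

(** The Gramian in the basis [b, A b, ...] with the powers of [T] of its
    leading entries divided out. *)
Definition scaled_gramian (T : R) : 'M[R]_m.+1 :=
  \matrix_(i, j) ((invmx K *m G T *m (invmx K)^T) i j / T ^+ (i + j).+1).

Let w : 'cV[R]_m.+1 := \col_i ((i`! * m.+1`! * (i + m + 2))%:R)^-1.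
Let e : 'cV[R]_m.+1 := delta_mx ord_max 0.

(** The correction of first order. It involves the last index only: for [i < m]
    the [i]-th coordinate of [e^{tA} b] in the basis [b, A b, ...] is
    [t^i / i!] without a term in [t^i.+1], as [A^i.+1 b] is another basis
    vector. *)
Definition scaled_gramian1 : 'M[R]_m.+1 := \tr A *: (w *m e^T + e *m w^T).

Lemma row_invmx_krylov (i : 'I_m.+1) k : (k <= i)%N ->
  (row i (invmx K) *m A ^+ k *m b) 0 0 = (k == i :> nat)%:R.
Proof.
move=> ki; have km : (k < m.+1)%N by rewrite (leq_ltn_trans ki).
rewrite rowE -!mulmxA -rowE mxE -[k]/(nat_of_ord (Ordinal km)) -col_krylov_mx.
by rewrite mulKmx ?kalman_unit // mxE eqxx andbT eq_sym.
Qed.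

Lemma row_invmx_krylovS (i : 'I_m.+1) :
  (row i (invmx K) *m A ^+ i.+1 *m b) 0 0 = (i == ord_max)%:R * \tr A.
Proof.
rewrite -(companion_diag kalAb) rowE -!mulmxA -rowE mxE -mulmx_exprS -col_krylov_mx.
by rewrite -[RHS]mulmx_delta !mulmxA.
Qed.

Lemma scaled_gramian_expansion : mx_expansion1 scaled_gramian H scaled_gramian1.
Proof.
move=> i j.
have := @expansion1_gramian_form _ _ A b (row i (invmx K)) (row j (invmx K)) i j.
have z (l : 'I_m.+1) k : (k < l)%N -> (row l (invmx K) *m A ^+ k *m b) 0 0 = 0.
  by move=> kl; rewrite row_invmx_krylov ?(ltnW kl) // ltn_eqF.
move=> /(_ (z i) (z j)) /=; rewrite !row_invmx_krylovS !row_invmx_krylov // !eqxx.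
have f0 k : k`!%:R != 0 :> R by rewrite pnatr_eq0 -lt0n fact_gt0.
have -> : true%:R / i`!%:R * (true%:R / j`!%:R) / (i + j).+1%:R = H i j :> R.
  by rewrite mxE addn1 !natrM !invfM /= !mul1r.
have -> : (true%:R / i`!%:R * ((j == ord_max)%:R * \tr A / j.+1`!%:R) +
   (i == ord_max)%:R * \tr A / i.+1`!%:R * (true%:R / j`!%:R)) / (i + j).+2%:R =
   scaled_gramian1 i j.
  have eT : e^T = delta_mx 0 ord_max by rewrite trmx_delta.
  rewrite 2!mxE eT; rewrite !mxE !big_ord1 !mxE !eqxx /= !andbT !addn2 !mul1r.
  have [->|] := eqVneq j ord_max; have [->|] := eqVneq i ord_max => /=;
    rewrite ?(mul0r, mulr0, addr0, add0r, mul1r, mulr1) // !natrM !invfM.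
  - by ring.
  - by move=> _; ring.
  - by move=> _; rewrite (addnC m j); ring.
apply: expansion1_ext => T; rewrite [RHS]mxE; congr (_ / _).
rewrite !rowE trmx_mul trmx_delta !mulmxA mulmx_delta -!mulmxA -rowE [LHS]mxE.
by rewrite !mulmxA.
Qed.

Let Hu : H \in unitmx := hilbert_fact_unit R m.+1.
Let wE i : w i 0 = ((i`! * m.+1`! * (i + m + 2))%:R)^-1.
Proof. by rewrite mxE. Qed.

Let Hw : e^T *m (invmx H *m w) = 2^-1%:M.
Proof.
rewrite trmx_delta -rowE; apply/matrixP => i j; rewrite !ord1 [LHS]mxE.
rewrite invmx_hilbert_next //.
by rewrite mxE eqxx mulr1n.
Qed.

Lemma trmx_invmx_hilbert : (invmx H)^T = invmx H.
Proof. by rewrite trmx_inv hilbert_fact_mx_sym. Qed.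

Let wH : w^T *m (invmx H *m e) = 2^-1%:M.
Proof.
by apply: trmx_inj; rewrite !trmx_mul trmxK trmx_invmx_hilbert -mulmxA Hw tr_scalar_mx.
Qed.

(** The trace of the companion matrix enters twice, each time with the factor
    1/2 of [invmx_hilbert_next]. *)
Lemma mxtrace_scaled_gramian1 : \tr (invmx H *m scaled_gramian1) = \tr A.
Proof.
rewrite -scalemxAr mxtraceZ mulmxDr mxtraceD (mulmxA _ w) (mulmxA _ e).
rewrite (mxtrace_mulC (invmx H *m w)) (mxtrace_mulC (invmx H *m e)) Hw wH.
by rewrite mxtrace_scalar mulr1n; field.
Qed.

Lemma scaled_gramian1_corner :
  (invmx H *m scaled_gramian1 *m invmx H) ord_max ord_max = \tr A / kappa R m.+1.
Proof.
have corner (M : 'M[R]_m.+1) : M ord_max ord_max = (e^T *m (M *m e)) 0 0.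
  by rewrite trmx_delta -rowE [RHS]mxE mulmx_delta.
rewrite corner -!scalemxAr -!scalemxAl -scalemxAr mxE; congr (_ * _).
rewrite -invmx_hilbert_corner [invmx H _ _]corner.
have -> : e^T *m (invmx H *m (w *m e^T + e *m w^T) *m invmx H *m e) =
    e^T *m (invmx H *m w) *m (e^T *m (invmx H *m e)) +
    e^T *m (invmx H *m e) *m (w^T *m (invmx H *m e)).
  by rewrite mulmxDr !mulmxDl mulmxDr !mulmxA.
rewrite Hw wH mul_scalar_mx mul_mx_scalar -scalerDl mxE.
by move: (fun_of_matrix _ _ _) => h; field.
Qed.

End ScaledGramian.

(** * Expansions of the Gramian and of its inverse *)

Lemma expansion1_exprn (R : realType) k :
  expansion1 (fun T : R => T ^+ k) (k == 0%N)%:R (k == 1%N)%:R.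
Proof.
case: k => [|[|k]] /=.
- by apply: expansion1_ext (expansion1_cst 1) => T; rewrite expr0.
- by apply: expansion1_ext (expansion1_id R) => T; rewrite expr1.
- exists 1; near=> T; have /andP[T0 T1] : 0 < T < 1 by near: T; exact: near0_itv.
  have [T0' T1'] := (ltW T0, ltW T1).
  by rewrite mul0r addr0 subr0 mul1r ger0_norm ?exprn_ge0 // ler_wiXn2l.
Unshelve. all: by end_near. Qed.

Lemma sum_delta (R : realType) n (l : 'I_n) (F : 'I_n -> R) :
  \sum_i (i == l)%:R * F i = F l.
Proof.
rewrite (bigD1 l) //= eqxx mul1r big1 ?addr0 // => i /negbTE ->.
by rewrite mul0r.
Qed.

(** The power of [T] is 0 at the corner [i = j = m] only, and 1 at the two
    neighbours of the corner only. So two orders of the sum depend on the last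
    row and the last column of [P] alone. *)
Lemma expansion1_dominant_form (R : realType) m (P : 'M[R]_m.+1)
    (M : R -> 'M[R]_m.+1) M0 M1 : mx_expansion1 M M0 M1 ->
  expansion1 (fun T => \sum_(i < m.+1) \sum_(j < m.+1)
      P j i * (T ^+ (2 * m - i - j) * M T i j))
    (P ord_max ord_max * M0 ord_max ord_max)
    (P ord_max ord_max * M1 ord_max ord_max +
     \sum_(i < m.+1 | i.+1 == m)
        (P i ord_max * M0 ord_max i + P ord_max i * M0 i ord_max)).
Proof.
move=> eM.
have e (i j : 'I_m.+1) := expansion1Z (P j i)
  (expansion1M (expansion1_exprn R (2 * m - i - j)) (eM i j)).
have := expansion1_sum (index_enum 'I_m.+1)
  (fun i => expansion1_sum (index_enum 'I_m.+1) (e i)).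
have k0 (i j : 'I_m.+1) : (2 * m - i - j == 0)%N%:R =
    (i == ord_max)%:R * (j == ord_max)%:R :> R.
  rewrite -natrM mulnb -!val_eqE /=; congr (_%:R); apply: congr1.
  by have := ltn_ord i; have := ltn_ord j; lia.
have k1 (i j : 'I_m.+1) : (2 * m - i - j == 1)%N%:R =
    (i == ord_max)%:R * (j.+1 == m)%:R + (j == ord_max)%:R * (i.+1 == m)%:R :> R.
  rewrite -!natrM -natrD !mulnb -!val_eqE /=; congr (_%:R).
  by have := ltn_ord i; have := ltn_ord j; lia.
have -> : \sum_(i < m.+1) \sum_(j < m.+1) P j i * ((2 * m - i - j == 0)%N%:R * M0 i j) =
    P ord_max ord_max * M0 ord_max ord_max.
  rewrite -(sum_delta ord_max (fun i => P ord_max i * M0 i ord_max)).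
  apply: eq_bigr => i _; rewrite -(sum_delta ord_max (fun j => P j i * M0 i j)).
  by rewrite mulr_sumr; apply: eq_bigr => j _; rewrite k0; ring.
suff -> : \sum_(i < m.+1) \sum_(j < m.+1) P j i * ((2 * m - i - j == 0)%N%:R * M1 i j +
      (2 * m - i - j == 1)%N%:R * M0 i j) =
    P ord_max ord_max * M1 ord_max ord_max +
    \sum_(i < m.+1 | i.+1 == m)
        (P i ord_max * M0 ord_max i + P ord_max i * M0 i ord_max) by [].
rewrite -(sum_delta ord_max (fun i => P ord_max i * M1 i ord_max)) big_split /=.
rewrite -(sum_delta ord_max (fun i => \sum_(j < m.+1 | j.+1 == m) P j i * M0 i j)).
rewrite [X in _ = _ + (_ + X)]big_mkcond /= addrA -!big_split /=; apply: eq_bigr => i _.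
rewrite -(sum_delta ord_max (fun j => P j i * M1 i j)).
rewrite [X in _ = _ + _ * X + _]big_mkcond !mulr_sumr /=.
have -> : (if i.+1 == m then P ord_max i * M0 i ord_max else 0) =
    (i.+1 == m)%:R * \sum_j (j == ord_max)%:R * (P j i * M0 i j).
  by rewrite sum_delta; case: eqP => _; rewrite ?mul1r ?mul0r.
rewrite mulr_sumr -!big_split /=; apply: eq_bigr => j _.
by rewrite k0 k1; case: (j.+1 == m) => /=; ring.
Qed.

Section InverseGramian.
Variables (R : realType) (m : nat) (A : 'M[R]_m.+1) (b : 'cV[R]_m.+1).
Hypothesis kalAb : kalman A b.
Let K := krylov_mx A b.
Notation G := (gramian A b).
Notation H := (hilbert_fact_mx R m.+1).
Notation h := (scaled_gramian A b).

Lemma gramian_krylov T : G T = K *m (invmx K *m G T *m (invmx K)^T) *m K^T.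
Proof.
rewrite trmx_inv !mulmxA mulmxV ?kalman_unit // mul1mx mulmxKV //.
by rewrite unitmx_tr kalman_unit.
Qed.

Let Ku : K \in unitmx := kalman_unit kalAb.

Let Gam T := invmx K *m G T *m (invmx K)^T.

Let GamE T i j : 0 < T -> Gam T i j = T ^+ (i + j).+1 * h T i j.
Proof.
by move=> T0; rewrite [h T i j]mxE mulrC divfK // expf_neq0 // gt_eqF.
Qed.

Lemma det_gramian T : 0 < T ->
  \det (G T) = \det K ^+ 2 * T ^+ (m.+1 ^ 2) * \det (h T).
Proof.
move=> T0; rewrite gramian_krylov -[_ *m G T *m _]/(Gam T) det_mulmx (det_mulmx K) det_tr.
pose D : 'rV[R]_m.+1 := \row_i T ^+ i.
have -> : Gam T = T *: (diag_mx D *m h T *m diag_mx D).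
  apply/matrixP => i j; rewrite GamE //; move: (h T) => X.
  by rewrite mul_mx_diag mul_diag_mx !mxE exprS exprD; ring.
rewrite detZ !det_mulmx det_diag.
have -> : \prod_i D 0 i = T ^+ (\sum_(i < m.+1) i).
  by rewrite expr_sum; apply: eq_bigr => i _; rewrite mxE.
have TE : T ^+ (m.+1 ^ 2) =
    T ^+ m.+1 * T ^+ (\sum_(i < m.+1) i) * T ^+ (\sum_(i < m.+1) i).
  rewrite -!exprD; congr (T ^+ _).
  rewrite -(big_mkord xpredT id) bin2_sum bin2 /=.
  by have := odd_double_half (m.+1 * m); rewrite oddM /= andNb; lia.
by rewrite TE; ring.
Qed.

Lemma invmx_gramian T : 0 < T -> h T \in unitmx -> G T \in unitmx /\
  forall Q : 'M[R]_m.+1, \tr (invmx (G T) *m Q) * T ^+ (2 * m).+1 =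
    \sum_(i < m.+1) \sum_(j < m.+1) (invmx K *m Q *m (invmx K)^T) j i *
      (T ^+ (2 * m - i - j) * invmx (h T) i j).
Proof.
move=> T0 hu; have TX k : T ^+ k != 0 by rewrite expf_neq0 // gt_eqF.
pose Gam' := \matrix_(i, j) (invmx (h T) i j / T ^+ (i + j).+1).
have GG' : Gam T *m Gam' = 1%:M.
  apply/matrixP => i j; transitivity (T ^+ i / T ^+ j * (h T *m invmx (h T)) i j).
    rewrite [in RHS]mxE mxE mulr_sumr; apply: eq_bigr => k _.
    rewrite GamE // [Gam' _ _]mxE !exprS !exprD; field.
    by rewrite !TX gt_eqF.
  rewrite mulmxV // !mxE; case: eqP => [->|_]; last by rewrite mulr0.
  by rewrite mulr1 divff.
have GX : G T *m ((invmx K)^T *m Gam' *m invmx K) = 1%:M.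
  rewrite gramian_krylov -[_ *m G T *m _]/(Gam T); move: (Gam T) GG' => Y GG'.
  rewrite !mulmxA -(mulmxA _ K^T) -trmx_mul mulVmx // trmx1 mulmx1 -(mulmxA K) GG' mulmx1.
  by rewrite mulmxV.
have [Gu _] := mulmx1_unit GX; split=> // Q.
have -> : invmx (G T) = (invmx K)^T *m Gam' *m invmx K.
  by rewrite -[RHS](mulKmx Gu) GX mulmx1.
rewrite -!mulmxA mxtrace_mulC -!mulmxA (mulmxA (invmx K)).
rewrite /mxtrace mulr_suml; apply: eq_bigr => i _.
rewrite mxE mulr_suml; apply: eq_bigr => j _.
rewrite [Gam' _ _]mxE; move: (invmx K *m Q *m _) => P.
have -> : T ^+ (2 * m).+1 = T ^+ (i + j).+1 * T ^+ (2 * m - i - j).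
  rewrite -exprD; congr (T ^+ _).
  by have := ltn_ord i; have := ltn_ord j; lia.
by move: (TX (i + j).+1) => ?; field.
Qed.

(** The hypotheses hold for [Q] the identity and for [Q] the projection on the
    last Krylov vector, so the trace of the inverse Gramian and its value at
    that vector have the same expansion. *)
Lemma expansion1_invmx_gramian (Q : 'M[R]_m.+1)
    (xi := invmx K *m krylov_q A b m.+1) (d := krylov_d A b m.+1)
    (P := invmx K *m Q *m (invmx K)^T) :
  (forall i, P i ord_max = xi i 0 / d) -> (forall i, P ord_max i = xi i 0 / d) ->
  expansion1 (fun T => \tr (invmx (G T) *m Q) * T ^+ (2 * m).+1)
    (kappa R m.+1 * d ^+ 2)^-1
    (- krylov_a A b m.+1 / (kappa R m.+1 * d ^+ 2)).
Proof.
move=> Pl Pr; have eh := scaled_gramian_expansion kalAb.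
have Hu := hilbert_fact_unit R m.+1.
have uh := mx_expansion1_unit Hu eh.
have d0 : d != 0 := krylov_d_neq0 kalAb.
have k0 : kappa R m.+1 != 0.
  by rewrite /kappa !(mulf_neq0, invr_neq0, expf_neq0) // pnatr_eq0 -lt0n fact_gt0.
have := expansion1_dominant_form P (mx_expansion1V Hu eh).
rewrite [fun_of_matrix (- _) _ _]mxE scaled_gramian1_corner invmx_hilbert_corner Pr.
rewrite invmx_krylov_q_last //.
have -> : \sum_(i < m.+1 | i.+1 == m)
      (P i ord_max * invmx H ord_max i + P ord_max i * invmx H i ord_max) =
    - ((kappa R m.+1)^-1 / d * \sum_(i < m.+1 | i.+1 == m) xi i 0).
  rewrite mulr_sumr -sumrN; apply: eq_bigr => i /eqP im.
  have -> : invmx H ord_max i = invmx H i ord_max.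
    by rewrite -[in LHS]trmx_invmx_hilbert mxE.
  rewrite invmx_hilbert_subcorner // Pl Pr.
  by field; rewrite k0 d0.
rewrite krylov_aE // -/d -/xi.
have -> : d^-1 / d * (kappa R m.+1)^-1 = (kappa R m.+1 * d ^+ 2)^-1.
  by field; rewrite k0 d0.
move: (\sum_(i < _ | _) _) => S.
have -> : d^-1 / d * - (\tr A / kappa R m.+1) - (kappa R m.+1)^-1 / d * S =
    - (\tr A + d * S) / (kappa R m.+1 * d ^+ 2).
  by field; rewrite k0 d0.
apply: expansion1_eq; near=> T.
have T0 : 0 < T by near: T; exact: nbhs_right_gt.
have hu : h T \in unitmx by near: T.
by have [_ ->] := invmx_gramian T0 hu.
Unshelve. all: by end_near. Qed.

Lemma expansion1_mxtrace_invmx_gramian (d := krylov_d A b m.+1) :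
  expansion1 (fun T => \tr (invmx (G T)) * T ^+ (2 * m).+1)
    (kappa R m.+1 * d ^+ 2)^-1 (- krylov_a A b m.+1 / (kappa R m.+1 * d ^+ 2)).
Proof.
have PE i : (invmx K *m 1%:M *m (invmx K)^T) i ord_max =
    (invmx K *m krylov_q A b m.+1) i 0 / d.
  by rewrite mulmx1 invmx_krylov_gram_last.
apply: expansion1_ext (expansion1_invmx_gramian PE _) => [T|i].
  by rewrite mulmx1.
have symN : (invmx K *m (invmx K)^T)^T = invmx K *m (invmx K)^T.
  by rewrite trmx_mul trmxK.
by rewrite -PE mulmx1 -[in LHS]symN mxE.
Qed.

Lemma expansion1_invmx_gramian_krylov_q
    (q := krylov_q A b m.+1) (d := krylov_d A b m.+1) :
  expansion1 (fun T => dotp q (invmx (G T) *m q) * T ^+ (2 * m).+1)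
    (kappa R m.+1 * d ^+ 2)^-1 (- krylov_a A b m.+1 / (kappa R m.+1 * d ^+ 2)).
Proof.
have PE i j : (invmx K *m (q *m q^T) *m (invmx K)^T) i j =
    (invmx K *m q) i 0 * (invmx K *m q) j 0.
  rewrite mulmxA -(mulmxA _ q^T) -trmx_mul mxE big_ord1; congr (_ * _).
  by rewrite mxE.
apply: expansion1_ext (@expansion1_invmx_gramian (q *m q^T) _ _) => [T|i|i].
- by rewrite mulmxA mxtrace_mulC trace_mx11 -dotpE.
- by rewrite PE invmx_krylov_q_last.
- by rewrite PE mulrC invmx_krylov_q_last.
Qed.

Lemma expansion1_det_scaled :
  expansion1 (fun T => \det (h T)) (\det H) (\det H * \tr A).
Proof.
rewrite -(mxtrace_scaled_gramian1 A); apply: expansion1_det.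
  exact: hilbert_fact_unit.
exact: scaled_gramian_expansion.
Qed.

End InverseGramian.

Section TopEigenvalue.
Variables (R : realType) (n : nat) (A : 'M[R]_n) (b : 'cV[R]_n).

Lemma expansion1_gramian_form0 (z : 'rV[R]_n) :
  expansion1 (fun T => (z *m gramian A b T *m z^T) 0 0 / T)
    ((z *m b) 0 0 * (z *m b) 0 0) ((z *m b) 0 0 * (z *m (A *m b)) 0 0).
Proof.
have z0 k : (k < 0)%N -> (z *m A ^+ k *m b) 0 0 = 0 by [].
have := expansion1_gramian_form z0 z0.
rewrite /= !expr0 !mulmx1 expr1 -!mulmxA fact0 !divr1.
have -> : ((z *m b) 0 0 * (z *m (A *m b)) 0 0 + (z *m (A *m b)) 0 0 * (z *m b) 0 0) / 2 =
    (z *m b) 0 0 * (z *m (A *m b)) 0 0 by field.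
by apply: expansion1_ext => T; rewrite expr1.
Qed.

Lemma expansion1_mxtrace_gramian :
  expansion1 (fun T => \tr (gramian A b T) / T) (dotp b b) (dotp b (A *m b)).
Proof.
have dE (i : 'I_n) (M : 'cV[R]_n) : (delta_mx (0 : 'I_1) i *m M) 0 0 = M i 0.
  by rewrite -rowE mxE.
have := expansion1_sum (index_enum 'I_n)
  (fun i => expansion1_gramian_form0 (delta_mx 0 i)).
under eq_bigr do rewrite !dE.
under [X in expansion1 _ _ X]eq_bigr do rewrite !dE.
apply: expansion1_ext => T; rewrite /mxtrace mulr_suml; apply: eq_bigr => i _.
by rewrite trmx_delta mulmx_delta -rowE mxE.
Qed.

Lemma expansion1_gramian_krylov_q1 : b != 0 ->
  expansion1 (fun T => dotp (krylov_q A b 1) (gramian A b T *m krylov_q A b 1) / T)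
    (dotp b b) (dotp b (A *m b)).
Proof.
move=> b0; rewrite krylov_q1; have := expansion1_gramian_form0 ((enorm b)^-1 *: b)^T.
rewrite -!dotpE !dotpZl.
have bb : enorm b * enorm b = dotp b b by rewrite -expr2 sqr_sqrtr ?dotp_ge0.
have e0 : enorm b != 0.
  by apply: contraNneq b0 => b0; rewrite -dotp_eq0 -bb b0 mulr0.
have -> : (enorm b)^-1 * dotp b b * ((enorm b)^-1 * dotp b b) = dotp b b.
  by rewrite -bb; field.
have -> : (enorm b)^-1 * dotp b b * ((enorm b)^-1 * dotp b (A *m b)) = dotp b (A *m b).
  by rewrite -bb; field.
by apply: expansion1_ext => T; rewrite trmxK -mulmxA -dotpE.
Qed.

End TopEigenvalue.

(** * Integration by parts for integrable functions *)

Section IntegrationByParts.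
Variable R : realType.
Implicit Types (f g F p : R -> R) (T : R).
Notation mu := (@lebesgue_measure R).
Notation integrable_on a b f := (mu.-integrable `[a, b]%classic (EFin \o f)).

Lemma within_integrable_on f a b : {within `[a, b], continuous f} -> integrable_on a b f.
Proof.
by move=> cf; apply: continuous_compact_integrable => //; exact: segment_compact.
Qed.

Lemma within_continuous_mul f g a b : {within `[a, b], continuous f} ->
  {within `[a, b], continuous g} -> {within `[a, b], continuous (fun t => f t * g t)}.
Proof. by move=> cf cg t; apply: cvgM; [exact: cf | exact: cg]. Qed.

Lemma integral_within_continuous f T : 0 <= T -> integrable_on 0 T f ->
  {within `[0, T], continuous (fun t => \int[mu]_(s in `[0, t]) f s)}.
Proof. by move=> T0 fi; exact: parameterized_integral_continuous. Qed.

Lemma continuous_bounded_on f T : continuous f ->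
  exists2 B, 0 <= B & forall t, 0 <= t <= T -> `|f t| <= B.
Proof.
move=> cf.
have /compact_bounded[M [_ MB]] : compact (f @` `[0, T]).
  by apply: continuous_compact; [exact: continuous_subspaceT | exact: segment_compact].
exists (`|M| + 1); first by rewrite addr_ge0.
move=> t t01; apply: (MB (`|M| + 1)).
  by rewrite (le_lt_trans (ler_norm _)) // ltrDl.
by exists t => //=; rewrite in_itv.
Qed.

Lemma integrable_on_mull f p T : integrable_on 0 T f -> continuous p ->
  integrable_on 0 T (fun t => p t * f t).
Proof.
move=> fi cp; have [B B0 pB] := continuous_bounded_on T cp.
have mf : measurable_fun `[0, T]%classic f.
  by case/integrableP: fi => /measurable_EFinP.
have mp : measurable_fun `[0, T]%classic p.
  by apply: measurable_funTS; exact: continuous_measurable_fun.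
apply: (@le_integrable _ _ _ mu _ _ _ (EFin \o (fun t => B * f t))) => //.
- by apply/measurable_EFinP; exact: measurable_funM.
- move=> t /=; rewrite in_itv /= => t0T; rewrite lee_fin !normrM (ger0_norm B0).
  by rewrite ler_wpM2r // pB.
- apply: (@eq_integrable _ _ _ mu _ _ (fun t => B%:E * (f t)%:E)%E) => //.
  by apply: (@integrableZl _ _ _ mu).
Qed.

Lemma is_derive_integral f T t : continuous f -> 0 < t < T ->
  is_derive t (1 : R) (fun t => \int[mu]_(s in `[0, t]) f s) (f t).
Proof.
move=> cf /andP[t0 tT].
have fi := continuous_integrable_on 0 T cf.
have [|dF F'] := @continuous_FTC1_closed R f 0 t T tT fi t0.
  exact: cf.
by apply: DeriveDef; [exact: dF | rewrite -derive1E; exact: F'].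
Qed.

Lemma LRcontinuous_within F f a b : a < b -> {within `[a, b], continuous F} ->
  (forall t, a < t < b -> is_derive t (1 : R) F (f t)) ->
  derivable_oo_LRcontinuous F a b /\ {in `]a, b[, derive1 F =1 f}.
Proof.
move=> ab /(continuous_within_itvP _ ab)[_ Fa Fb] dF; split.
  by split=> // t; rewrite in_itv /= => /dF dFt; exact: ex_derive.
by move=> t; rewrite in_itv /= => /dF dFt; rewrite derive1E; exact: derive_val.
Qed.

Lemma continuous_by_parts p p' f T : 0 < T -> continuous p' ->
  (forall t, is_derive t (1 : R) p (p' t)) -> continuous f ->
  \int[mu]_(t in `[0, T]) (p t * f t) = p T * \int[mu]_(t in `[0, T]) f t -
    \int[mu]_(t in `[0, T]) (p' t * \int[mu]_(s in `[0, t]) f s).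
Proof.
move=> T0 cp' dp cf; have cp := is_derive_continuous dp.
have [dp1 dp2] := LRcontinuous_within T0 (continuous_subspaceT cp) (fun t _ => dp t).
have [dF1 dF2] := LRcontinuous_within T0
  (integral_within_continuous (ltW T0) (continuous_integrable_on 0 T cf))
  (fun t => is_derive_integral cf).
rewrite (Rintegration_by_parts T0 (continuous_subspaceT cp') dp1 dp2
  (continuous_subspaceT cf) dF1 dF2).
by rewrite [in X in _ - _ * X - _]set_itv1 Rintegral_set1 mulr0 subr0.
Qed.

Lemma integrable_onS f t T : 0 <= t <= T -> integrable_on 0 T f -> integrable_on 0 t f.
Proof.
move=> /andP[t0 tT]; apply: integrableS => //.
by apply: subset_itvl; rewrite bnd_simp.
Qed.

Lemma le_normr_Rintegral_sub f t T : 0 <= t <= T -> integrable_on 0 T f ->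
  `|\int[mu]_(s in `[0, t]) f s| <= \int[mu]_(s in `[0, T]) `|f s|.
Proof.
move=> tT fi; have ft := integrable_onS tT fi.
apply: le_trans (le_normr_Rintegral _ ft) _ => //.
have nfi : mu.-integrable `[0, T]%classic (EFin \o (fun s => `|f s|)).
  by have := integrable_norm fi.
rewrite /Rintegral; apply: fine_le.
- by apply: integrable_fin_num => //; exact: integrable_onS nfi.
- exact: integrable_fin_num nfi.
- apply: ge0_subset_integral => //.
  + by case/integrableP: nfi.
  + by move/andP: tT => [_ tT]; apply: subset_itvl; rewrite bnd_simp.
Qed.

(** An indefinite integral need not be differentiable everywhere; both sides
    are continuous in [f] for the L1 norm, in which continuous functions are
    dense. *)
Lemma integrable_by_parts p p' f T : 0 < T -> continuous p' ->
  (forall t, is_derive t (1 : R) p (p' t)) -> integrable_on 0 T f ->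
  \int[mu]_(t in `[0, T]) (p t * f t) = p T * \int[mu]_(t in `[0, T]) f t -
    \int[mu]_(t in `[0, T]) (p' t * \int[mu]_(s in `[0, t]) f s).
Proof.
move=> T0 cp' dp fi; have cp := is_derive_continuous dp.
have [B B0 pB] := continuous_bounded_on T cp.
have [B' B'0 p'B] := continuous_bounded_on T cp'.
have muT : (mu `[0%R, T]%classic < +oo)%E.
  by rewrite /= lebesgue_measure_itv /= lte_fin T0 -EFinB ltry.
have [g [cg gi gf]] :=
  approximation_continuous_integrable (measurable_itv `[0, T]) muT fi.
pose dl n t := f t - g n t.
have dli n : integrable_on 0 T (dl n).
  by apply: (@eq_integrable _ _ _ mu _ _ (fun t => (f t)%:E - (g n t)%:E)%E) => //;
    exact: (@integrableB _ _ _ mu _ _ (EFin \o f) (EFin \o g n)).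
pose e n := \int[mu]_(t in `[0, T]) `|dl n t|.
have e0 : e n @[n --> \oo] --> 0.
  exact: (@fine_cvg _ _ _ _ _ 0 gf).
pose err h := \int[mu]_(t in `[0, T]) (p t * h t) - (p T * \int[mu]_(t in `[0, T]) h t -
    \int[mu]_(t in `[0, T]) (p' t * \int[mu]_(s in `[0, t]) h s)).
have errM n : `|err f| <= (B + B + B' * T) * e n.
  have dE t : 0 <= t <= T -> \int[mu]_(s in `[0, t]) dl n s =
      \int[mu]_(s in `[0, t]) f s - \int[mu]_(s in `[0, t]) g n s.
    by move=> tT; rewrite RintegralB //; exact: integrable_onS tT _.
  have prodi h : integrable_on 0 T h ->
      integrable_on 0 T (fun t => p' t * \int[mu]_(s in `[0, t]) h s).
    move=> hi; apply: within_integrable_on; apply: within_continuous_mul.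
      exact: continuous_subspaceT.
    exact: integral_within_continuous (ltW T0) hi.
  have -> : err f =
      \int[mu]_(t in `[0, T]) (p t * dl n t) - p T * \int[mu]_(t in `[0, T]) dl n t +
      \int[mu]_(t in `[0, T]) (p' t * \int[mu]_(s in `[0, t]) dl n s).
    have -> : \int[mu]_(t in `[0, T]) (p t * dl n t) =
        \int[mu]_(t in `[0, T]) (p t * f t) - \int[mu]_(t in `[0, T]) (p t * g n t).
      rewrite -RintegralB //; try exact: integrable_on_mull.
      by apply: eq_Rintegral => t _; rewrite mulrBr.
    have -> : \int[mu]_(t in `[0, T]) (p' t * \int[mu]_(s in `[0, t]) dl n s) =
        \int[mu]_(t in `[0, T]) (p' t * \int[mu]_(s in `[0, t]) f s) -
        \int[mu]_(t in `[0, T]) (p' t * \int[mu]_(s in `[0, t]) g n s).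
      rewrite -RintegralB //; try exact: prodi.
      apply: eq_Rintegral => t /set_mem; rewrite /= in_itv /= => /dE ->.
      by rewrite mulrBr.
    rewrite dE ?lexx ?ltW // (continuous_by_parts T0 cp' dp (cg n)) /err; ring.
  have e0T : 0 <= e n by exact: Rintegral_ge0.
  rewrite !mulrDl; apply: le_trans (ler_normD _ _) _; apply: lerD.
    apply: le_trans (ler_normB _ _) _; apply: lerD.
      apply: le_trans (le_normr_Rintegral _ (integrable_on_mull (dli n) cp)) _ => //.
      rewrite -RintegralZl //; last by have := integrable_norm (dli n).
      apply: le_Rintegral => //.
      - by have := integrable_norm (integrable_on_mull (dli n) cp).
      - apply: integrable_on_mull (@cst_continuous _ _ B).
        by have := integrable_norm (dli n).
      - by move=> t /=; rewrite in_itv /= => t0T; rewrite normrM ler_wpM2r // pB.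
    rewrite normrM; apply: ler_pM => //; first by apply: pB; rewrite lexx ltW.
    by apply: le_normr_Rintegral_sub; rewrite ?lexx ?ltW.
  apply: le_trans (le_normr_Rintegral _ (prodi _ (dli n))) _ => //.
  have -> : B' * T * e n = \int[mu]_(t in `[0, T]) (B' * e n).
    rewrite Rintegral_cst // /= lebesgue_measure_itv /= lte_fin T0 /= subr0.
    by rewrite mulrAC.
  apply: le_Rintegral => //.
  - by have := integrable_norm (prodi _ (dli n)).
  - by apply: continuous_integrable_on; exact: cst_continuous.
  - move=> t /=; rewrite in_itv /= => t0T; rewrite normrM ler_pM ?p'B //.
    exact: le_normr_Rintegral_sub.
apply/eqP; rewrite -subr_eq0 -normr_eq0 eq_le normr_ge0 andbT -/(err f).
have : (B + B + B' * T) * e n @[n --> \oo] --> 0.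
  by rewrite -[X in _ --> X](mulr0 (B + B + B' * T)); exact: cvgMl_tmp.
by move/cvgr_to_ge; apply; exact: nearW.
Qed.

End IntegrationByParts.

(** * Calculus on an interval and square-integrable controls *)

Section ControlCalculus.
Variable R : realType.
Implicit Types (f g F : R -> R) (a b T : R).
Notation mu := (@lebesgue_measure R).
Notation integrable_on a b f := (mu.-integrable `[a, b]%classic (EFin \o f)).

Lemma is_derive_mul f g t df dg : is_derive t (1 : R) f df -> is_derive t (1 : R) g dg ->
  is_derive t (1 : R) (fun s => f s * g s) (f t * dg + g t * df).
Proof. by move=> ? ?; exact: is_deriveM. Qed.

Lemma is_derive_bigsum (I : Type) (s : seq I) (h : I -> R -> R) (d : I -> R) t :
  (forall i, is_derive t (1 : R) (h i) (d i)) ->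
  is_derive t (1 : R) (fun u => \sum_(i <- s) h i u) (\sum_(i <- s) d i).
Proof.
move=> hd; elim: s => [|i s IH].
  rewrite big_nil (_ : (fun _ => _) = cst 0); first exact: is_derive_cst.
  by apply/funext => u; rewrite big_nil.
rewrite big_cons (_ : (fun _ => _) = h i + (fun u => \sum_(j <- s) h j u)).
  exact: is_deriveD.
by apply/funext => u; rewrite big_cons.
Qed.

Lemma continuous_bigsum (U : topologicalType) (I : Type) (s : seq I) (h : I -> U -> R) :
  (forall i, continuous (h i)) -> continuous (fun t => \sum_(i <- s) h i t).
Proof.
move=> ch; elim: s => [|i s IH].
  rewrite (_ : (fun _ => _) = cst 0); last by apply/funext => u; rewrite big_nil.
  by move=> t; exact: cvg_cst.
rewrite (_ : (fun _ => _) = (fun t => h i t + \sum_(j <- s) h j t)); last first.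
  by apply/funext => u; rewrite big_cons.
by move=> t; apply: cvgD; [exact: ch | exact: IH].
Qed.

Lemma within_continuous_sum (I : Type) (s : seq I) (h : I -> R -> R) (D : set R) :
  (forall i, {within D, continuous (h i)}) ->
  {within D, continuous (fun t => \sum_(i <- s) h i t)}.
Proof. exact: (@continuous_bigsum (subspace D)). Qed.

Lemma within_continuous_mx m n (D : set R) (x : R -> 'M[R]_(m, n)) :
  (forall i j, {within D, continuous (fun t => x t i j)}) -> {within D, continuous x}.
Proof.
move=> cx t S [P nP sPS].
have : \forall s \near nbhs (t : subspace D), forall i j, P i j (x s i j).
  by apply: filter_forall => i; apply: filter_forall => j; exact: cx (nP i j).
by apply: filterS => s Ps; apply: sPS => i j; exact: Ps.
Qed.

Lemma within_continuous_entry m n (D : set R) (x : R -> 'M[R]_(m, n)) i j :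
  {within D, continuous x} -> {within D, continuous (fun t => x t i j)}.
Proof.
by move=> cx t; exact: cvg_comp (cx t) (@coord_continuous _ m n i j (x t)).
Qed.

Lemma Rintegral_FTC_within F f a b : a <= b -> {within `[a, b], continuous f} ->
  {within `[a, b], continuous F} ->
  (forall t, a < t < b -> is_derive t (1 : R) F (f t)) ->
  \int[mu]_(x in `[a, b]) f x = F b - F a.
Proof.
rewrite le_eqVlt => /predU1P[-> _ _ _|ab cf cF dF].
  by rewrite set_itv1 Rintegral_set1 subrr.
have [dF1 dF2] := LRcontinuous_within ab cF dF.
by rewrite /Rintegral (@continuous_FTC2 _ f F) // ?fineB.
Qed.

Lemma is_derive_reverse F f T t : (forall s, is_derive s (1 : R) F (f s)) ->
  is_derive t (1 : R) (fun s => F (T - s)) (- f (T - t)).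
Proof.
move=> dF; rewrite -mulrN1.
apply: (@is_derive1_comp _ F (fun s => T - s)).
rewrite (_ : (fun s => T - s) = cst T - id) //.
by apply: is_derive_eq; rewrite sub0r.
Qed.

Lemma continuous_reverse F T : continuous F -> continuous (fun s => F (T - s)).
Proof.
move=> cF s; apply: continuous_comp; last exact: cF.
by apply: cvgB; [exact: cvg_cst | exact: cvg_id].
Qed.

Lemma L2_integrable_sqr T (u : R -> R) : L2_control T u ->
  integrable_on 0 T (fun t => u t ^+ 2).
Proof.
move=> [mu1 iu].
have mu2 : measurable_fun `]0, T[%classic (fun t => u t ^+ 2).
  exact: measurable_funX.
apply/integrableP; split.
  by apply/measurable_EFinP; exact: measurable_fun_itv_cc mu2.
rewrite integral_itv_bndoo; last first.
  by apply/measurable_EFinP; exact: measurableT_comp.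
case/integrableP: iu => _; under eq_integral do rewrite real_normK ?num_real //.
by [].
Qed.

Lemma L2_integrable T (u : R -> R) : 0 < T -> L2_control T u -> integrable_on 0 T u.
Proof.
move=> T0 uL; have iu2 := L2_integrable_sqr uL.
apply: (@le_integrable _ _ _ mu _ _ _ (EFin \o (fun t => 1 + u t ^+ 2))) => //.
- by apply/measurable_EFinP; exact: measurable_fun_itv_cc uL.1.
- move=> t _ /=; rewrite lee_fin [leRHS]ger0_norm ?addr_ge0 ?sqr_ge0 //.
  rewrite -real_normK ?num_real //; have := sqr_ge0 (`|u t| - 1 / 2).
  by have := normr_ge0 (u t); nra.
- apply: (@eq_integrable _ _ _ mu _ _ (fun t => 1%:E + (u t ^+ 2)%:E)%E) => //.
  apply: (@integrableD _ _ _ mu _ _ (EFin \o cst 1) (EFin \o (fun t => u t ^+ 2))) => //.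
  by apply: continuous_integrable_on; exact: cst_continuous.
Qed.

Lemma energy_Rintegral T (u : R -> R) : L2_control T u ->
  energy T u = (\int[mu]_(t in `[0, T]) (u t ^+ 2))%:E.
Proof.
move=> uL; have iu2 := L2_integrable_sqr uL.
rewrite /Rintegral fineK ?integrable_fin_num // integral_itv_bndoo; last first.
  by apply/measurable_EFinP; apply: measurable_funX; exact: uL.1.
by apply: eq_integral => t _; rewrite real_normK ?num_real.
Qed.

End ControlCalculus.

(** * Controls of minimal energy *)

Section Control.
Variables (R : realType) (n : nat) (A : 'M[R]_n) (b : 'cV[R]_n).
Notation mu := (@lebesgue_measure R).
Notation integrable_on a b f := (mu.-integrable `[a, b]%classic (EFin \o f)).
Notation G := (gramian A b).
Implicit Types (z : 'rV[R]_n) (T : R).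

(** The solution of the adjoint equation [p' = - p A], [p(T) = z]. *)
Definition adjoint z T (j : 'I_n) (t : R) : R := expmx_pair A z (delta_mx j 0) (T - t).

(** The control of minimal energy among those that reach [gramian A b T *m z^T]. *)
Definition optimal_control z T (t : R) : R := expmx_pair A z b (T - t).

Lemma expmx_pair_col z (c : 'cV[R]_n) t :
  expmx_pair A z c t = \sum_j expmx_pair A z (delta_mx j 0) t * c j 0.
Proof.
rewrite {1}/expmx_pair mxE; apply: eq_bigr => j _.
by rewrite /expmx_pair mulmx_delta.
Qed.

Lemma continuous_adjoint z T j : continuous (adjoint z T j).
Proof. by apply: continuous_reverse; exact: continuous_expmx_pair. Qed.

Lemma continuous_optimal_control z T : continuous (optimal_control z T).
Proof. by apply: continuous_reverse; exact: continuous_expmx_pair. Qed.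

Lemma optimal_controlE z T t : optimal_control z T t = \sum_j adjoint z T j t * b j 0.
Proof. exact: expmx_pair_col. Qed.

Lemma is_derive_adjoint z T j t :
  is_derive t (1 : R) (adjoint z T j) (- \sum_k adjoint z T k t * A k j).
Proof.
have := is_derive_reverse T t (is_derive_expmx_pair A z (delta_mx j 0)).
rewrite expmx_pair_mulA expmx_pair_col.
by under eq_bigr do rewrite mulmx_delta.
Qed.

Lemma adjoint_end z T j : adjoint z T j T = z 0 j.
Proof. by rewrite /adjoint subrr expmx_pair0 mulmx_delta. Qed.

(** Integrating [(p x)' = p b u] along a trajectory from [0]. *)
Lemma control_duality z T u x : 0 < T -> integrable_on 0 T u ->
  is_solution A b T u x -> x 0 = 0 ->
  \int[mu]_(t in `[0, T]) (optimal_control z T t * u t) = (z *m x T) 0 0.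
Proof.
move=> T0 ui [cx xE] x0.
pose f i t := (A *m x t + u t *: b) i 0.
have cxi i : {within `[0, T], continuous (fun t => x t i 0)}.
  exact: within_continuous_entry cx.
have fE i t : f i t = \sum_k A i k * x t k 0 + u t * b i 0 by rewrite /f !mxE.
have xi i t : 0 <= t <= T -> x t i 0 = \int[mu]_(s in `[0, t]) f i s.
  by move=> /xE ->; rewrite x0 mxE add0r.
have cAx i : {within `[0, T], continuous (fun t => \sum_k A i k * x t k 0)}.
  apply: within_continuous_sum => k; apply: within_continuous_mul (cxi k).
  by apply: continuous_subspaceT; exact: cst_continuous.
have fi i : integrable_on 0 T (f i).
  apply: (@eq_integrable _ _ _ mu _ _
    (fun t => (\sum_k A i k * x t k 0)%:E + (b i 0 * u t)%:E)%E) => //.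
    by move=> t _; rewrite /= fE (mulrC (u t)).
  apply: (@integrableD _ _ _ mu _ _ (EFin \o (fun t => \sum_k A i k * x t k 0))
     (EFin \o (fun t => b i 0 * u t))) => //; first exact: within_integrable_on.
  by apply: integrable_on_mull => //; exact: cst_continuous.
pose p := adjoint z T; pose p' i t := - \sum_k p k t * A k i.
have cp' i : continuous (p' i).
  move=> t; apply: cvgN; move: t; apply: continuous_bigsum => k t; apply: cvgMr_tmp.
  exact: continuous_adjoint.
have parts i : \int[mu]_(t in `[0, T]) (p i t * f i t) =
   z 0 i * x T i 0 - \int[mu]_(t in `[0, T]) (p' i t * x t i 0).
  rewrite (integrable_by_parts T0 (cp' i) (is_derive_adjoint z T i) (fi i)).
  rewrite -xi ?lexx ?ltW // adjoint_end; congr (_ - _).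
  by apply: eq_Rintegral => t /set_mem; rewrite /= in_itv /= => /xi ->.
have pfi i : integrable_on 0 T (fun t => p i t * f i t).
  by apply: integrable_on_mull => //; exact: continuous_adjoint.
have pxi i : integrable_on 0 T (fun t => p' i t * x t i 0).
  by apply: integrable_on_mull => //; exact: within_integrable_on.
have -> : (z *m x T) 0 0 = \sum_i (\int[mu]_(t in `[0, T]) (p i t * f i t) +
    \int[mu]_(t in `[0, T]) (p' i t * x t i 0)).
  by rewrite mxE; apply: eq_bigr => i _; rewrite parts subrK.
rewrite big_split /= -!Rintegral_sum // -RintegralD //; try exact: integrable_on_sum.
apply: eq_Rintegral => t _; rewrite optimal_controlE -big_split /= mulr_suml.
have -> : \sum_i (p i t * f i t + p' i t * x t i 0) =
    \sum_i p i t * b i 0 * u t +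
    (\sum_i \sum_k p i t * A i k * x t k 0 - \sum_i \sum_k p k t * A k i * x t i 0).
  rewrite -sumrB -big_split /=; apply: eq_bigr => i _.
  rewrite fE /p' mulrDr mulr_sumr mulNr mulr_suml.
  have -> : \sum_k p i t * (A i k * x t k 0) = \sum_k p i t * A i k * x t k 0.
    by apply: eq_bigr => k _; rewrite mulrA.
  by ring.
by rewrite [X in _ - X]exchange_big /= subrr addr0.
Qed.

(** Differentiating [e^{tA} b (e^{tA} b)^T] gives the Lyapunov equation of the
    Gramian. *)
Lemma gramian_lyapunov T i j : 0 <= T ->
  (A *m G T + G T *m A^T) i j =
  expmx_pair A (delta_mx 0 i) b T * expmx_pair A (delta_mx 0 j) b T - b i 0 * b j 0.
Proof.
move=> T0; pose v k := expmx_pair A (delta_mx 0 k) b.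
have dv k t : is_derive t (1 : R) (v k) (expmx_pair A (delta_mx 0 k *m A) b t).
  exact: is_derive_expmx_pair.
have bE k : b k 0 = v k 0 by rewrite /v expmx_pair0 -rowE mxE.
have cv k : continuous (expmx_pair A (delta_mx 0 k *m A) b).
  exact: continuous_expmx_pair.
have cv1 k : continuous (v k) by exact: continuous_expmx_pair.
rewrite !bE -/(v i T) -/(v j T).
rewrite -(Rintegral_FTC T0 _ (fun t => is_derive_mul (dv i t) (dv j t))).
  rewrite RintegralD //; try by apply: continuous_integrable_on; apply: continuous_mul.
  have -> : \int[mu]_(t in `[0, T]) (v j t * expmx_pair A (delta_mx 0 i *m A) b t) =
      (A *m G T) i j.
    under eq_Rintegral do rewrite mulrC.
    by rewrite -gramian_form trmx_delta mulmx_delta -!mulmxA -rowE mxE.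
  rewrite -gramian_form trmx_mul trmx_delta !mulmxA mulmx_delta -!mulmxA -rowE.
  rewrite [row _ _ _ _]mxE.
  by rewrite mxE addrC.
by move=> t; apply: cvgD; apply: continuous_mul.
Qed.

Definition optimal_state z T (t : R) : 'cV[R]_n := G t *m \col_j adjoint z T j t.

(** The state [G(t) p(t)] is differentiated by the product rule; the Lyapunov
    equation turns the derivative into [A x + b u]. *)
Lemma optimal_state_solution z T : 0 < T ->
  [/\ is_solution A b T (optimal_control z T) (optimal_state z T),
      optimal_state z T 0 = 0 & optimal_state z T T = G T *m z^T].
Proof.
move=> T0; pose v k := expmx_pair A (delta_mx 0 k) b.
pose p := adjoint z T.
have [x xdef] : exists x, x = optimal_state z T by exists (optimal_state z T).
rewrite -xdef.
have cv i j : continuous (fun t => v i t * v j t).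
  by apply: continuous_mul; exact: continuous_expmx_pair.
have cp j : continuous (p j) by exact: continuous_adjoint.
have GE i j t : G t i j = \int[mu]_(s in `[0, t]) (v i s * v j s) by exact: gramian_entry.
have xE t i : x t i 0 = \sum_j G t i j * p j t.
  by rewrite xdef [LHS]mxE; apply: eq_bigr => j _; rewrite [X in _ * X]mxE.
have cG i j : {within `[0, T], continuous (fun t => G t i j)}.
  rewrite (_ : (fun t => G t i j) =
    (fun t => \int[mu]_(s in `[0, t]) (v i s * v j s)));
    last by apply/funext => s.
  by apply: (integral_within_continuous (ltW T0)); exact: continuous_integrable_on.
have cxi i : {within `[0, T], continuous (fun t => x t i 0)}.
  rewrite (_ : (fun t => x t i 0) = (fun t => \sum_j G t i j * p j t));
    last by apply/funext => s.
  apply: within_continuous_sum => j; apply: within_continuous_mul => //.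
  exact: continuous_subspaceT.
have x0 : x 0 = 0.
  apply/matrixP => i j; rewrite ord1 xE [RHS]mxE big1 // => k _.
  by rewrite GE set_itv1 Rintegral_set1 mul0r.
pose f i t := (A *m x t + optimal_control z T t *: b) i 0.
have fE i t : f i t = \sum_k A i k * x t k 0 + optimal_control z T t * b i 0.
  by rewrite /f !mxE.
have cf i : {within `[0, T], continuous (f i)}.
  rewrite (_ : f i =
    (fun t => \sum_k A i k * x t k 0 + optimal_control z T t * b i 0));
    last by apply/funext => s.
  move=> t; apply: cvgD; move: t.
    apply: within_continuous_sum => k; apply: within_continuous_mul (cxi k).
    by apply: continuous_subspaceT; exact: cst_continuous.
  apply: within_continuous_mul; apply: continuous_subspaceT.
    exact: continuous_optimal_control.
  exact: cst_continuous.
have dx i t : 0 < t < T -> is_derive t (1 : R) (fun t => x t i 0) (f i t).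
  move=> tT; have dG j : is_derive t (1 : R) (fun t => G t i j) (v i t * v j t).
    rewrite (_ : (fun _ => _) = (fun t => \int[mu]_(s in `[0, t]) (v i s * v j s))).
      exact: (is_derive_integral (cv i j) tT).
    by apply/funext => s.
  rewrite (_ : (fun t => x t i 0) = (fun t => \sum_j G t i j * p j t)); last first.
    by apply/funext => s.
  have := is_derive_bigsum (index_enum 'I_n)
    (fun j => is_derive_mul (dG j) (is_derive_adjoint z T j t)).
  suff -> : f i t = \sum_j (G t i j * - (\sum_k adjoint z T k t * A k j) +
      adjoint z T j t * (v i t * v j t)) by [].
  have L j : v i t * v j t = (A *m G t) i j + (G t *m A^T) i j + b i 0 * b j 0.
    have t0 : 0 <= t by case/andP: tT => /ltW.
    have := gramian_lyapunov i j t0; rewrite mxE => ->.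
    by rewrite -/(v i t) -/(v j t) subrK.
  under [RHS]eq_bigr do rewrite L.
  rewrite fE optimal_controlE.
  have -> : \sum_k A i k * x t k 0 = \sum_j p j t * (A *m G t) i j.
    under eq_bigr do rewrite xE mulr_sumr.
    rewrite exchange_big /=; apply: eq_bigr => j _.
    by rewrite [(A *m _) _ _]mxE mulr_sumr; apply: eq_bigr => k _; ring.
  have GA : \sum_j G t i j * (\sum_k p k t * A k j) = \sum_j p j t * (G t *m A^T) i j.
    under eq_bigr do rewrite mulr_sumr.
    rewrite exchange_big /=; apply: eq_bigr => j _.
    by rewrite mxE mulr_sumr; apply: eq_bigr => k _; rewrite [A^T _ _]mxE; ring.
  rewrite mulr_suml -/p; under [RHS]eq_bigr do rewrite mulrN !mulrDr addrC.
  rewrite big_split /= sumrN GA !big_split /=.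
  rewrite (_ : \sum_i0 p i0 t * (b i 0 * b i0 0) = \sum_i0 p i0 t * b i0 0 * b i 0).
    by ring.
  by apply: eq_bigr => j _; ring.
split=> //; last first.
  rewrite xdef; congr (_ *m _); apply/matrixP => i j.
  by rewrite ord1 !mxE; exact: adjoint_end.
split; first by apply: within_continuous_mx => i j; rewrite ord1; exact: cxi.
move=> t /andP[t0 tT] i; have x00 : x 0 i 0 = 0 by rewrite x0 mxE.
rewrite x00 add0r.
have sub : `[0, t] `<=` `[0, T] by apply: subset_itvl; rewrite bnd_simp.
rewrite -[RHS]/(\int[mu]_(s in `[0, t]) f i s).
have dx' s : 0 < s < t -> is_derive s (1 : R) (fun t => x t i 0) (f i s).
  by move=> /andP[s0 st]; apply: dx; rewrite s0 (lt_le_trans st).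
rewrite (Rintegral_FTC_within t0 (continuous_subspaceW sub (cf i))
  (continuous_subspaceW sub (cxi i)) dx').
by rewrite x00 subr0.
Qed.

Lemma continuous_L2_control T (u : R -> R) : continuous u -> L2_control T u.
Proof.
move=> cu; split.
  by apply: measurable_funTS; exact: continuous_measurable_fun.
apply: (@integrableS _ _ _ mu `[0, T]%classic) => //.
  exact: subset_itv_oo_cc.
apply: (@continuous_integrable_on _ (fun t => `|u t| ^+ 2)) => t.
apply: (@continuous_comp _ _ _ (fun t => `|u t|) (fun x : R => x ^+ 2)).
  by apply: cvg_norm; exact: cu.
exact: exprn_continuous.
Qed.

Lemma optimal_control_admissible z T : 0 < T ->
  admissible A b T (G T *m z^T) (optimal_control z T).
Proof.
move=> T0; split.
  by apply: continuous_L2_control; exact: continuous_optimal_control.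
by exists (optimal_state z T); exact: optimal_state_solution.
Qed.

Lemma energy_optimal_control z T : 0 < T ->
  energy T (optimal_control z T) = ((z *m G T *m z^T) 0 0)%:E.
Proof.
move=> T0; have [uL [x [sx x0 xT]]] := optimal_control_admissible z T0.
rewrite energy_Rintegral // -mulmxA -xT.
rewrite -(control_duality z T0 (L2_integrable T0 uL) sx x0).
by under eq_Rintegral do rewrite expr2.
Qed.

(** With [w] the optimal control, [|u|^2 >= 2 u w - |w|^2], and the duality
    gives [u w] and [w^2] the same integral. *)
Lemma energy_ge z T u : 0 < T -> admissible A b T (G T *m z^T) u ->
  (((z *m G T *m z^T) 0 0)%:E <= energy T u)%E.
Proof.
move=> T0 [uL [x [sx x0 xT]]]; pose w := optimal_control z T.
have cw : continuous w by exact: continuous_optimal_control.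
have wL : L2_control T w by exact: continuous_L2_control.
have ui := L2_integrable T0 uL.
have := energy_optimal_control z T0; rewrite !energy_Rintegral // => -[Ew].
have Euw : \int[mu]_(t in `[0, T]) (w t * u t) = (z *m G T *m z^T) 0 0.
  by rewrite (control_duality z T0 ui sx x0) xT mulmxA.
have iuw : integrable_on 0 T (fun t => w t * u t) by exact: integrable_on_mull.
have iw2 := L2_integrable_sqr wL; have iu2 := L2_integrable_sqr uL.
have iuw2 : integrable_on 0 T (fun t => 2 * (w t * u t)).
  by apply: integrable_on_mull => //; exact: cst_continuous.
have -> : (z *m G T *m z^T) 0 0 = \int[mu]_(t in `[0, T]) (2 * (w t * u t) - w t ^+ 2).
  by rewrite RintegralB // RintegralZl // Euw Ew; ring.
rewrite lee_fin; apply: le_Rintegral => //.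
- apply: (@eq_integrable _ _ _ mu _ _
    (fun t => (2 * (w t * u t))%:E - (w t ^+ 2)%:E)%E) => //.
  exact: (@integrableB _ _ _ mu _ _ (EFin \o (fun t => 2 * (w t * u t)))
    (EFin \o (fun t => w t ^+ 2))).
- by move=> t _; have := sqr_ge0 (u t - w t); nra.
Qed.

(** Both bounds come from the same [z], the solution of [G z^T = y]. *)
Lemma min_energy T y : 0 < T -> G T \in unitmx ->
  ereal_inf (energy T @` admissible A b T y) = (dotp y (invmx (G T) *m y))%:E.
Proof.
move=> T0 Gu; pose z := (invmx (G T) *m y)^T.
have yE : G T *m z^T = y by rewrite trmxK mulKVmx.
have -> : dotp y (invmx (G T) *m y) = (z *m G T *m z^T) 0 0.
  by rewrite -mulmxA yE dotpC dotpE.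
apply/eqP; rewrite eq_le; apply/andP; split.
  apply: ereal_inf_lbound; exists (optimal_control z T).
    by rewrite -[X in admissible _ _ _ X]yE; exact: optimal_control_admissible.
  exact: energy_optimal_control.
apply: le_ereal_inf_tmp => _ [u ua <-]; apply: energy_ge => //.
by rewrite yE.
Qed.

Lemma worst_energyE T : (0 < n)%N -> 0 < T -> G T \in unitmx ->
  worst_energy A b T = ((lambda A b T n)^-1)%:E.
Proof.
move=> n0 T0 Gu; have symG := gramian_sym A b T; have psdG := gramian_psd A b T.
apply/eqP; rewrite eq_le; apply/andP; split.
  apply: ge_ereal_sup => _ [y y1 <-]; rewrite min_energy // lee_fin.
  have yy : dotp y y = 1 by rewrite -[LHS]sqr_sqrtr ?dotp_ge0 // -/(enorm y) y1 expr1n.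
  by have := invmx_form_le n0 symG psdG Gu y; rewrite yy mulr1.
have [v v1 vE] := invmx_form_eq n0 symG psdG Gu.
apply: ereal_sup_ubound; exists v; first by rewrite /= /enorm v1 sqrtr1.
by rewrite min_energy // vE.
Qed.

End Control.

(** * The three expansions *)

Lemma expansion1_bigO (R : realType) (f : R -> R) b : expansion1 f 1 b ->
  (fun T => f T - (1 + b * T)) =O_ (0^'+) (fun T : R => T ^+ 2).
Proof.
move=> [C fC]; apply/eqO_exP; exists (`|C| + 1); first by rewrite ltr_wpDl.
near=> T; have fT : `|f T - (1 + b * T)| <= C * T ^+ 2 by near: T.
apply: le_trans fT _; rewrite [`|T ^+ 2|]ger0_norm ?sqr_ge0 //.
by apply: ler_wpM2r; rewrite ?sqr_ge0 // (le_trans (ler_norm _)) // lerDl.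
Unshelve. all: by end_near. Qed.

Lemma expansion1_relative (R : realType) (f : R -> R) c b : c != 0 ->
  expansion1 f c (c * b) ->
  exists2 r : R -> R, r =O_ (0^'+) (fun T : R => T ^+ 2) &
    forall T, f T = c * (1 + b * T + r T).
Proof.
move=> c0 ef; exists (fun T => c^-1 * f T - (1 + b * T)).
  by apply: expansion1_bigO; have := expansion1Z c^-1 ef; rewrite mulKf // mulVf.
by move=> T; rewrite addrC subrK mulVKf.
Qed.

Theorem corollary2 (R : realType) (n : nat) (hn : (0 < n)%N)
    (A : 'M[R]_n) (b : 'cV[R]_n) (hAb : kalman A b) :
  [/\ exists2 r : R -> R, r =O_ (0^'+) (fun T : R => T ^+ 2) &
        \forall T \near 0^'+,
          worst_energy A b T =
          (T ^- (2 * n - 1) / (kappa R n * krylov_d A b n ^+ 2)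
            * (1 - krylov_a A b n * T + r T))%:E,
      exists2 r : R -> R, r =O_ (0^'+) (fun T : R => T ^+ 2) &
        \forall T \near 0^'+,
          \det (gramian A b T) =
          \det (krylov_mx A b) ^+ 2 * \det (hilbert_fact_mx R n)
            * T ^+ (n ^ 2) * (1 + \tr A * T + r T)
    & exists2 r : R -> R, r =O_ (0^'+) (fun T : R => T ^+ 2) &
        \forall T \near 0^'+,
          lambda A b T 1 / lambda A b T n =
          krylov_d A b 1 ^+ 2 / (kappa R n * krylov_d A b n ^+ 2)
            * T ^- (2 * (n - 1))
            * (1 + (krylov_a A b 1 - krylov_a A b n) * T + r T)].
Proof.
case: n hn A b hAb => // m hn A b hAb.
have d0 := krylov_d_neq0 hAb.
have k0 : kappa R m.+1 != 0.
  by rewrite /kappa !(mulf_neq0, invr_neq0, expf_neq0) // pnatr_eq0 -lt0n fact_gt0.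
set c := kappa R m.+1 * krylov_d A b m.+1 ^+ 2.
have c0 : c != 0 by rewrite mulf_neq0 // expf_neq0.
have b0 : b != 0.
  apply/eqP => b0; move: d0.
  by rewrite /krylov_d b0 mulmx0 dotpE mulmx0 mxE eqxx.
have bb0 : dotp b b != 0 by rewrite dotp_eq0.
have bb : enorm b ^+ 2 = dotp b b by rewrite sqr_sqrtr // dotp_ge0.
have e0 : enorm b != 0 by rewrite -sqrf_eq0 bb.
have d1E : krylov_d A b 1 ^+ 2 = dotp b b.
  by rewrite /krylov_d krylov_q1 expr0 mul1mx dotpZl -bb; field.
have a1E : dotp b (A *m b) = dotp b b * krylov_a A b 1.
  by rewrite /krylov_a krylov_q1 -scalemxAr dotpZl dotpZr -bb; field.
have q1 : dotp (krylov_q A b 1) (krylov_q A b 1) = 1.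
  by rewrite krylov_q1; exact: enorm_normalize.
have eh := scaled_gramian_expansion hAb.
have uG : \forall T \near 0^'+, gramian A b T \in unitmx.
  have uh := mx_expansion1_unit (hilbert_fact_unit R m.+1) eh.
  near=> T; have T0 : 0 < T by near: T; exact: nbhs_right_gt.
  by have [|//] := invmx_gramian hAb T0; near: T.
have psdG T := gramian_psd A b T; have symG T := gramian_sym A b T.
have eN : expansion1 (fun T => (lambda A b T m.+1)^-1 * T ^+ (2 * m).+1)
    c^-1 (c^-1 * - krylov_a A b m.+1).
  rewrite mulrC; apply: expansion1_squeeze (expansion1_invmx_gramian_krylov_q hAb)
    (expansion1_mxtrace_invmx_gramian hAb); near=> T.
  have T0 : 0 < T by near: T; exact: nbhs_right_gt.
  have uT : gramian A b T \in unitmx by near: T.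
  have Tk : 0 <= T ^+ (2 * m).+1 by rewrite exprn_ge0 // ltW.
  have /andP[lo up] :=
    last_eigenvalue_inv_bounds hn (symG T) (psdG T) uT (krylov_q_unit hAb).
  by rewrite !ler_wpM2r.
have e1 : expansion1 (fun T => lambda A b T 1 / T) (dotp b b) (dotp b b * krylov_a A b 1).
  rewrite -a1E; apply: expansion1_squeeze (expansion1_gramian_krylov_q1 A b0)
    (expansion1_mxtrace_gramian A b); near=> T.
  have T0 : 0 < T by near: T; exact: nbhs_right_gt.
  have /andP[lo up] := first_eigenvalue_bounds hn (symG T) (psdG T) q1.
  by rewrite !ler_wpM2r // invr_ge0 ltW.
have dH : \det (hilbert_fact_mx R m.+1) != 0.
  by have := hilbert_fact_unit R m.+1; rewrite unitmxE unitfE.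
have TE k (T : R) : 0 < T -> T ^+ k != 0 by move=> T0; rewrite expf_neq0 // gt_eqF.
split.
- have [r rO rE] := expansion1_relative (invr_neq0 c0) eN.
  exists r => //; near=> T.
  have T0 : 0 < T by near: T; exact: nbhs_right_gt.
  rewrite worst_energyE //; last by near: T.
  congr (_%:E); rewrite (_ : 2 * m.+1 - 1 = (2 * m).+1)%N; last by lia.
  rewrite -mulNr -mulrA -rE mulrC mulfK //; exact: TE.
- have [r rO rE] := expansion1_relative dH (expansion1_det_scaled hAb).
  exists r => //; near=> T.
  have T0 : 0 < T by near: T; exact: nbhs_right_gt.
  by rewrite (det_gramian hAb T0) rE; ring.
- have e : expansion1
      (fun T => lambda A b T 1 / T * ((lambda A b T m.+1)^-1 * T ^+ (2 * m).+1))
      (krylov_d A b 1 ^+ 2 / c)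
      (krylov_d A b 1 ^+ 2 / c * (krylov_a A b 1 - krylov_a A b m.+1)).
    have := expansion1M e1 eN; rewrite d1E.
    by congr expansion1; ring.
  have [|r rO rE] := expansion1_relative _ e.
    by rewrite mulf_neq0 ?invr_neq0 // d1E.
  exists r => //; near=> T.
  have T0 : 0 < T by near: T; exact: nbhs_right_gt.
  rewrite mulrAC -rE (_ : 2 * (m.+1 - 1) = 2 * m)%N; last by lia.
  rewrite exprS; move: (TE (2 * m)%N T T0) (TE 1%N T T0) => P2 P1.
  have T1 : T != 0 by rewrite gt_eqF.
  move: (lambda A b T m.+1)^-1 => l; by field; rewrite T1 P2.
Unshelve. all: by end_near. Qed.
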